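(* Let $m\ge 1$, let $H,H_0,H_1,\dots,H_m$ be finite-dimensional (real) Hilbert spaces and assume that $\dim(H_j)>0$ for all $j\ge 1$. Let $\ell_j:H\to H_j$ be linear transformations for $0\le j\le m$, which are surjective for all $j\ge 1$. Let $p_j\in[1,\infty]$ for $1\le j\le m$. Then there exists $C<\infty$ such that $$\int_{\{y\in H:\,|\ell_0(y)|\le 1\}}\prod_{j=1}^m f_j(\ell_j(y))\,dy\le C\prod_{j=1}^m\|f_j\|_{L^{p_j}(H_j)}$$ for all nonnegative Lebesgue measurable functions $f_j$ on $H_j$ ($1\le j\le m$), if and only if both $$\dim(V)\le\sum_{j=1}^m p_j^{-1}\dim(\ell_j(V))\quad\text{for all linear subspaces } V\subset\ker(\ell_0)$$ and $$\operatorname{codim}_H(V)\ge\sum_{j=1}^m p_j^{-1}\operatorname{codim}_{H_j}(\ell_j(V))\quad\text{for all linear subspaces } V\subset H.$$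
   Context: Each finite-dimensional Hilbert space is equipped with its canonical Lebesgue measure, obtained by choosing an orthonormal basis and identifying the space with $\mathbb{R}^{d}$, $d$ its dimension. $\operatorname{codim}_W(V)=\dim(W)-\dim(V)$ denotes the codimension of a subspace $V\subset W$ in $W$. The space $H_0$ is allowed to have dimension zero. The convention $\infty^{-1}=0$ is used. *)

(* Defs.v *)
From HB Require Import structures.
From mathcomp Require Export all_boot all_order all_algebra sesquilinear.
From mathcomp Require Export all_classical all_reals all_analysis.

Set Implicit Arguments.
Unset Strict Implicit.
Unset Printing Implicit Defensive.
Import Order.TTheory GRing.Theory Num.Theory.
Import numFieldNormedType.Exports.

Local Open Scope classical_set_scope.
Local Open Scope ring_scope.

HB.mixin Record hasInner (R : realType) E of GRing.Lmodule R E :=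
  { inner : {dot E for (idfun : R -> R)} }.

(* Finite-dimensional real Hilbert spaces. Completeness is automatic, and the
   zero space is allowed. *)
#[short(type="hilbertType")]
HB.structure Definition Hilbert (R : realType) :=
  { E of GRing.Lmodule R E & Vector R E & hasInner R E }.

Definition hnorm (R : realType) (E : hilbertType R) (u : E) : R :=
  Num.sqrt (inner u u).

Definition codim (R : realType) (E : hilbertType R) (V : {vspace E}) : nat :=
  (\dim {:E} - \dim V)%N.

Section OrthonormalBasis.
Context {R : realType} (E : hilbertType R).

Definition is_onb (e : (\dim {:E}).-tuple E) : Prop :=
  basis_of fullv e /\
  forall i j, inner (tnth e i) (tnth e j) = (i == j)%:R.

Let innerC (u v : E) : inner u v = inner v u.
Proof. by rewrite (hermC (inner : {dot E for idfun})) expr0 mul1r. Qed.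

Lemma exists_onb : exists e, is_onb e.
Proof.
suff /(_ (\dim {:E}) (leqnn _)) [e onE] : forall n, (n <= \dim {:E})%N ->
    exists e : n.-tuple E, forall i j, inner (tnth e i) (tnth e j) = (i == j)%:R.
  exists e; split => //; rewrite basisEfree subvf size_tuple leqnn !andbT.
  apply/freeP => k sk0 i.
  have := congr1 (inner (tnth e i)) sk0; rewrite linear0r linear_sumr/=.
  rewrite (bigD1 i)//= -tnth_nth linearZr_LR/= onE eqxx mulr1 big1 ?addr0// => j ji.
  by rewrite -tnth_nth linearZr_LR/= onE eq_sym (negbTE ji) mulr0.
elim=> [|n IH] n1; first by exists [tuple] => -[].
have [e onE] := IH (ltnW n1).
have [v _ vNe] : exists2 v, v \in fullv & v \notin <<e>>%VS.
  apply/subvPn; apply: contraL n1 => /dimvS le; rewrite -leqNgt.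
  by rewrite (leq_trans le)// (leq_trans (dim_span _))// size_tuple.
pose w := v - \sum_(i < n) inner (tnth e i) v *: tnth e i.
have w0 : w != 0.
  apply: contra vNe; rewrite subr_eq0 => /eqP ->.
  by apply: memv_suml => i _; rewrite memvZ// memv_span// mem_tnth.
have ow i : inner (tnth e i) w = 0.
  rewrite linearBr/= linear_sumr/= (bigD1 i)//= linearZr_LR/= onE eqxx mulr1.
  by rewrite big1 ?addr0 ?subrr// => j ji;
    rewrite linearZr_LR/= onE eq_sym (negbTE ji) mulr0.
have ww : 0 < inner w w by exact: neq0_dnorm_gt0.
pose u := (Num.sqrt (inner w w))^-1 *: w.
have uu : inner u u = 1.
  rewrite linearZl_LR linearZr_LR/= mulrA -invfM -expr2 sqr_sqrtr ?ltW//.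
  by rewrite mulVf// gt_eqF.
have ou i : inner (tnth e i) u = 0 by rewrite linearZr_LR/= ow mulr0.
exists [tuple of u :: e] => i j.
case: (unliftP ord0 i) => [i'|] ->; case: (unliftP ord0 j) => [j'|] ->;
  rewrite ?tnthS ?tnth0 ?onE ?(inj_eq lift_inj) ?uu ?ou// innerC ou.
by [].
Qed.

Definition onb : (\dim {:E}).-tuple E := sval (cid exists_onb).

Lemma onbP : is_onb onb. Proof. exact: svalP (cid exists_onb). Qed.

Definition onb_coords (v : E) : (\dim {:E}).-tuple (measurableTypeR R) :=
  [tuple coord onb i v | i < \dim {:E}].

End OrthonormalBasis.

Section LebesgueTuple.
Context {R : realType}.
Local Open Scope ereal_scope.

Section cons.
Variables (n : nat)
  (mu : {sigma_finite_measure set (n.-tuple (measurableTypeR R)) -> \bar R}).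

Definition tuple_cons (x : measurableTypeR R * n.-tuple (measurableTypeR R)) :
  n.+1.-tuple (measurableTypeR R) := [tuple of x.1 :: x.2].

Lemma measurable_tuple_cons : measurable_fun [set: _] tuple_cons.
Proof. exact: measurable_cons. Qed.

Definition lebesgue_cons : set (n.+1.-tuple (measurableTypeR R)) -> \bar R :=
  pushforward (lebesgue_measure \x mu) tuple_cons.

Let lebesgue_cons0 : lebesgue_cons set0 = 0.
Proof. by rewrite /lebesgue_cons /pushforward preimage_set0 measure0. Qed.

Let lebesgue_cons_ge0 A : 0 <= lebesgue_cons A.
Proof. by rewrite /lebesgue_cons /pushforward measure_ge0. Qed.

Let lebesgue_cons_sigma_additive : semi_sigma_additive lebesgue_cons.
Proof.
have mcons A : measurable A -> measurable (tuple_cons @^-1` A).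
  by move=> mA; rewrite -[X in measurable X]setTI; exact: measurable_tuple_cons.
move=> F mF tF mUF; rewrite /lebesgue_cons /pushforward preimage_bigcup.
apply: measure_semi_sigma_additive.
- by move=> k; exact: mcons.
- apply/trivIsetP => /= i j _ _ ij; rewrite -preimage_setI.
  by move/trivIsetP : tF => /(_ _ _ _ _ ij) ->//; rewrite preimage_set0.
- by rewrite -preimage_bigcup; exact: mcons.
Qed.

HB.instance Definition _ := isMeasure.Build _ _ _ lebesgue_cons
  lebesgue_cons0 lebesgue_cons_ge0 lebesgue_cons_sigma_additive.

Let lebesgue_cons_sigma_finite : sigma_finite [set: _] lebesgue_cons.
Proof.
have /sigma_finiteP[F [TF ndF Foo]] := sigma_finiteT (@lebesgue_measure R).
have /sigma_finiteP[G [TG ndG Goo]] := sigma_finiteT mu.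
pose g (t : n.+1.-tuple (measurableTypeR R)) := (thead t, [tuple of behead t]).
have mg : measurable_fun [set: _] g.
  by apply/measurable_fun_pair; [exact: measurable_tnth|exact: measurable_behead].
have gK : cancel tuple_cons g.
  by case=> a t; rewrite /g /tuple_cons theadE/=; congr pair; exact: val_inj.
exists (fun k => g @^-1` (F k `*` G k)).
  apply/seteqP; split => // t _.
  have [k _ Fk] : (\bigcup_k F k) (g t).1 by rewrite -TF.
  have [l _ Gl] : (\bigcup_k G k) (g t).2 by rewrite -TG.
  exists (maxn k l) => //; split.
  - by move: Fk; exact/subsetPset/ndF/leq_maxl.
  - by move: Gl; exact/subsetPset/ndG/leq_maxr.
move=> k; have [mFk Fkoo] := Foo k; have [mGk Gkoo] := Goo k.
split; first by rewrite -[X in measurable X]setTI; apply: mg => //; exact: measurableX.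
rewrite /lebesgue_cons /pushforward -comp_preimage.
rewrite (_ : g \o tuple_cons = id) ?preimage_id; last exact/funext.
by rewrite product_measure1E// lte_mul_pinfty// ge0_fin_numE.
Qed.

HB.instance Definition _ := @Measure_isSigmaFinite.Build _ _ _ lebesgue_cons
  lebesgue_cons_sigma_finite.

End cons.

(* Lebesgue measure on the Borel sets of R^n. *)
Fixpoint lebesgue_tuple (n : nat) :
    {sigma_finite_measure set (n.-tuple (measurableTypeR R)) -> \bar R} :=
  match n with
  | 0 => \d_([tuple] : 0.-tuple (measurableTypeR R))
  | n'.+1 => lebesgue_cons (lebesgue_tuple n')
  end.

End LebesgueTuple.

Section LebesgueHilbert.
Context {R : realType} (E : hilbertType R).
Local Open Scope ereal_scope.

HB.instance Definition _ := isPointed.Build E 0%R.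

(* Outer measure induced on E by the Borel-Lebesgue measure, through the
   coordinates in an orthonormal basis; its Caratheodory measurable sets are
   those of the completion. *)
Definition lebesgue_outer (A : set E) : \bar R :=
  ((lebesgue_tuple (\dim {:E}))^*)%mu (@onb_coords R E @` A).

Let lebesgue_outer0 : lebesgue_outer set0 = 0.
Proof. by rewrite /lebesgue_outer image_set0 outer_measure0. Qed.

Let lebesgue_outer_ge0 A : 0 <= lebesgue_outer A.
Proof. exact: outer_measure_ge0. Qed.

Let le_lebesgue_outer : {homo lebesgue_outer : A B / A `<=` B >-> A <= B}.
Proof. by move=> A B AB; apply: le_outer_measure; exact: image_subset. Qed.

Let lebesgue_outer_sigma_subadditive : sigma_subadditive lebesgue_outer.
Proof.
by move=> F; rewrite /lebesgue_outer image_bigcup; exact: outer_measure_sigma_subadditive.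
Qed.

HB.instance Definition _ := isOuterMeasure.Build R E lebesgue_outer
  lebesgue_outer0 lebesgue_outer_ge0 le_lebesgue_outer
  lebesgue_outer_sigma_subadditive.

(* E with the sigma-algebra of its Lebesgue (not only Borel) measurable sets. *)
Definition lebesgue_space := caratheodory_type lebesgue_outer.

HB.instance Definition _ := Measurable.on lebesgue_space.

Definition lebesgue : set lebesgue_space -> \bar R := lebesgue_outer.

Let lebesgue0 : lebesgue set0 = 0.
Proof. exact: lebesgue_outer0. Qed.

Let lebesgue_ge0 A : 0 <= lebesgue A.
Proof. exact: lebesgue_outer_ge0. Qed.

Let lebesgue_sigma_additive : semi_sigma_additive lebesgue.
Proof. exact: caratheodory_measure_sigma_additive. Qed.

HB.instance Definition _ := isMeasure.Build _ _ _ lebesgue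
  lebesgue0 lebesgue_ge0 lebesgue_sigma_additive.

End LebesgueHilbert.
Arguments lebesgue {R} E A.

(* Main.v *)
(** Replacing [f_j] by its power [p_j] turns the inequality into
    [int prod f_j(l_j y)^(s_j) <= C prod (int f_j)^(s_j)] with [s_j = 1/p_j], which also
    makes sense for [s_j = 0].  Since only dimensions of subspaces matter, the conditions cut
    out a polytope of exponents [s].  By Hoelder's inequality the set of admissible [s] is
    convex, so [s] may be moved in two opposite directions until a new constraint becomes an
    equality.  If a proper nonzero subspace [V] is critical (one of its two inequalities is
    an equality), Fubini along [V] and a complement splits the inequality into two
    inequalities of the same kind on spaces of smaller dimension.  If there is none and all
    [s_j] are 0 or 1, the common kernel of the [l_j] with [s_j = 1] is critical, hence trivial,
    and the inequality is a change of variables.  Necessity follows by testing on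
    indicators of images of boxes with side [r] along [V] and [rho] along a complement, as
    [r] tends to infinity or [rho] to 0.

    Linear changes of variables are only needed up to a constant, so they follow from the
    uniqueness of translation-invariant measures, which is a consequence of Tonelli's
    theorem. *)

From HB Require Import structures.
Require Import Defs.
From mathcomp Require Import ring lra zify measurable_realfun ess_sup_inf.
Set Implicit Arguments.
Unset Strict Implicit.
Unset Printing Implicit Defensive.
Import Order.TTheory GRing.Theory Num.Theory.
Import numFieldNormedType.Exports.
Import passmx.
Local Open Scope classical_set_scope.
Local Open Scope ring_scope.
Local Open Scope ereal_scope.

(** The subspaces 0 and H yield constraints too, and both say how sum_j s_j n_j compares with n.
    When such a constraint binds, nothing factors; this is the obstacle to moving exponents. With
    two exponents strictly between 0 and 1, the direction is chosen to keep sum_j s_j n_j constant.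
    With only one, the identity sum_j s_j n_j = n itself makes the common kernel of the maps with
    exponent 1 a proper nonzero critical subspace. The induction is on n and then on the number of
    exponents strictly between 0 and 1.

    Subspaces are row spaces of matrices, and constants are only required to be finite, so neither
    determinants nor a sharp form of Hoelder's inequality enter.

    A second obstacle is measurability: the f_j are Lebesgue and not Borel measurable. They are
    replaced by Borel majorants, which differ from them on null sets; surjectivity of l_j makes the
    preimages of null sets null. *)

(** The integral of a nonnegative function is a supremum over the simple functions below it, hence
    monotone without any measurability. This applies to integrands that contain [f j (l j y)] for a
    Lebesgue measurable [f j]. *)
Lemma ge0_le_integral_nomeas d (T : measurableType d) (R : realType)
    (mu : {measure set T -> \bar R}) (D : set T) (f g : T -> \bar R) :
  (forall x, D x -> 0 <= f x) -> (forall x, D x -> f x <= g x) ->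
  \int[mu]_(x in D) f x <= \int[mu]_(x in D) g x.
Proof.
move=> f0 fg.
have g0 x : D x -> 0 <= g x by move=> Dx; exact: le_trans (f0 _ Dx) (fg _ Dx).
rewrite !ge0_integralE//; apply: le_ereal_sup => _ [h hf <-]; exists h => // x.
apply: le_trans (hf x) _; rewrite !patchE; case: ifPn => // xD.
by apply: fg; rewrite inE in xD.
Qed.

Section BrascampLieb.
Context {R : realType}.
Local Notation T n := (n.-tuple (measurableTypeR R)).
Local Notation lam := (@lebesgue_tuple R).

(** * Row vectors, affine maps, boxes and translation invariance of Lebesgue measure *)

Definition row_of n (t : T n) : 'rV[R]_n := \row_i tnth t i.
Definition tuple_of_row n (v : 'rV[R]_n) : T n := [tuple v ord0 i | i < n].

Lemma row_ofK n : cancel (@row_of n) (@tuple_of_row n).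
Proof.
by move=> t; apply: eq_from_tnth => i; rewrite tnth_mktuple mxE.
Qed.

Lemma tuple_of_rowK n : cancel (@tuple_of_row n) (@row_of n).
Proof. by move=> v; apply/rowP => i; rewrite mxE tnth_mktuple. Qed.

Lemma measurable_tuple_of_row d (X : measurableType d) n (h : X -> 'rV[R]_n) :
  (forall i, measurable_fun [set: X] (fun x => h x ord0 i : measurableTypeR R)) ->
  measurable_fun [set: X] (fun x => tuple_of_row (h x)).
Proof.
move=> mh; apply/measurable_fun_tnthP => i.
rewrite (_ : _ \o _ = fun x => h x ord0 i); first exact: mh.
by apply/funext => x /=; rewrite tnth_mktuple.
Qed.

Lemma measurable_row_mul d (X : measurableType d) a n (h : X -> T a)
    (M : 'M[R]_(a, n)) (i : 'I_n) :
  measurable_fun [set: X] h ->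
  measurable_fun [set: X] (fun x => (row_of (h x) *m M) ord0 i : measurableTypeR R).
Proof.
move=> mh; under eq_fun do rewrite mxE.
apply: measurable_sum => k; apply: measurable_funM; last exact: measurable_cst.
under eq_fun do rewrite mxE.
exact: (measurableT_comp (measurable_tnth k) mh).
Qed.

Definition affine2 a b n (V : 'M[R]_(a, n)) (W : 'M[R]_(b, n)) (c : 'rV[R]_n)
    (x : T a) (y : T b) : T n :=
  tuple_of_row (row_of x *m V + row_of y *m W + c).

Definition linear_map a n (M : 'M[R]_(a, n)) (x : T a) : T n :=
  tuple_of_row (row_of x *m M).

Definition translate n (c : 'rV[R]_n) (x : T n) : T n :=
  tuple_of_row (row_of x + c).

Lemma measurable_affine2 d (X : measurableType d) a b n (V : 'M[R]_(a, n))
    (W : 'M[R]_(b, n)) (c : 'rV[R]_n) (f : X -> T a) (g : X -> T b) :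
  measurable_fun [set: X] f -> measurable_fun [set: X] g ->
  measurable_fun [set: X] (fun x => affine2 V W c (f x) (g x)).
Proof.
move=> mf mg; apply: measurable_tuple_of_row => i.
under eq_fun do rewrite mxE [X in (X + _)%R]mxE.
apply: measurable_funD => //; apply: measurable_funD; exact: measurable_row_mul.
Qed.

Lemma measurable_linear_map a n (M : 'M[R]_(a, n)) :
  measurable_fun [set: T a] (linear_map M).
Proof.
by apply: measurable_tuple_of_row => i; exact: (measurable_row_mul _ _ (@measurable_id _ _ _)).
Qed.

Lemma measurable_translate n (c : 'rV[R]_n) : measurable_fun [set: T n] (translate c).
Proof.
apply: measurable_tuple_of_row => i.
under eq_fun do rewrite mxE.
apply: measurable_funD => //; under eq_fun do rewrite mxE.
exact: measurable_tnth.
Qed.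

Definition box n (r : R) : set (T n) := [set t | forall i, (`|tnth t i| <= r)%R].

Lemma measurable_box n r : measurable (@box n r).
Proof.
rewrite (_ : box r = \bigcap_(i in [set: 'I_n]) ((fun t => tnth t i) @^-1` [set x | (`|x| <= r)%R])).
  apply: fin_bigcap_measurable => // i _.
  rewrite -[X in measurable X]setTI; apply: measurable_tnth => //.
  rewrite (_ : [set _ | _] = `[(- r)%R, r]%classic)//.
  by apply/seteqP; split => x /=; rewrite in_itv/= ler_norml.
by apply/seteqP; split => t /= h => [i _|i]; exact: h.
Qed.

Lemma lebesgue_measure_translate (A : set (measurableTypeR R)) (a : R) :
  measurable A ->
  pushforward lebesgue_measure
    (fun x : measurableTypeR R => (x + a)%R : measurableTypeR R) A = lebesgue_measure A.
Proof.
have ma : measurable_fun setT (fun x : measurableTypeR R => (x + a)%R : measurableTypeR R).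
  exact: measurable_funD.
(* Packed as a measurable function, the translation has a pushforward that is a measure by
   inference, as uniqueness of Lebesgue measure on half-open intervals requires. *)
pose am := isMeasurableFun.Build _ _ _ _ _ ma.
pose F : {mfun _ >-> _} := HB.pack (fun x : measurableTypeR R => (x + a)%R : measurableTypeR R) am.
move=> mA; rewrite -[LHS]/(pushforward lebesgue_measure F A).
apply/esym/lebesgue_measure_unique => //= _ [[b c]] _ <-.
rewrite /pushforward (_ : _ @^-1` _ = `](b - a)%R, (c - a)%R]%classic); last first.
  by apply/seteqP; split => x /=; rewrite !in_itv/= ltrBlDr lerBrDr.
rewrite !lebesgue_measure_itv/= !lte_fin ltrD2r -EFinD -EFinD.
by case: ifPn => // _; congr EFin; lra.
Qed.

Lemma ge0_integral_translate1 (f : measurableTypeR R -> \bar R) (a : R) :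
  measurable_fun setT f -> (forall x, 0 <= f x) ->
  \int[lebesgue_measure]_x f (x + a)%R = \int[lebesgue_measure]_x f x.
Proof.
move=> mf f0.
have ma : measurable_fun setT (fun x : measurableTypeR R => (x + a)%R : measurableTypeR R).
  exact: measurable_funD.
have := @ge0_integral_pushforward _ _ _ _ R _ ma lebesgue_measure setT f measurableT mf (fun x _ => f0 x).
rewrite preimage_setT => <-.
by apply: eq_measure_integral => A mA _; exact: lebesgue_measure_translate.
Qed.

Lemma ge0_integral_tupleS n (f : T n.+1 -> \bar R) :
  measurable_fun setT f -> (forall x, 0 <= f x) ->
  \int[lam n.+1]_t f t =
  \int[lebesgue_measure]_x \int[lam n]_t f [tuple of x :: t].
Proof.
move=> mf f0.
have mc := @measurable_tuple_cons R n.
have := @ge0_integral_pushforward _ _ _ _ R _ mc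
  (lebesgue_measure \x lam n) setT f measurableT mf (fun x _ => f0 x).
rewrite preimage_setT => ->.
have mfc : measurable_fun setT (f \o @tuple_cons R n) by exact: (measurableT_comp mf mc).
by rewrite (fubini_tonelli1 _ mfc)// => x; exact: f0.
Qed.

Lemma translate_cons n (c : 'rV[R]_n.+1) (x : R) (t : T n) :
  translate c [tuple of x :: t] =
  [tuple of (x + c ord0 ord0)%R :: translate (\row_i c ord0 (lift ord0 i)) t].
Proof.
apply: eq_from_tnth => i; rewrite tnth_mktuple !mxE.
case: (unliftP ord0 i) => [j|] ->; last by rewrite !tnth0.
by rewrite !tnthS tnth_mktuple !mxE.
Qed.

Lemma ge0_integral_translate n (f : T n -> \bar R) (c : 'rV[R]_n) :
  measurable_fun setT f -> (forall x, 0 <= f x) ->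
  \int[lam n]_x f (translate c x) = \int[lam n]_x f x.
Proof.
elim: n f c => [|n IH] f c mf f0.
  by apply: eq_integral => x _; rewrite (tuple0 x) (tuple0 (translate c _)).
have mfc := measurableT_comp mf (measurable_translate c).
rewrite !ge0_integral_tupleS//.
pose g (x : measurableTypeR R) := \int[lam n]_t f [tuple of x :: t].
rewrite -[RHS](@ge0_integral_translate1 g (c ord0 ord0)).
- apply: eq_integral => x _; rewrite /g.
  rewrite -(IH (fun t => f [tuple of (x + c ord0 ord0)%R :: t])
    (\row_i c ord0 (lift ord0 i)))//.
    by apply: eq_integral => t _; rewrite translate_cons.
  apply: (measurableT_comp mf); exact: measurable_cons.
- apply: (measurable_fun_fubini_tonelli_F (f \o @tuple_cons R n)) => //.
  exact: (measurableT_comp mf (@measurable_tuple_cons R n)).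
- by move=> x; exact: f0.
- by move=> x; apply: integral_ge0 => t _; exact: f0.
Qed.

Lemma lebesgue_tuple_box n r : (0 <= r)%R -> lam n (box r) = (((2 * r) ^+ n)%R)%:E.
Proof.
move=> r0; elim: n => [|n IH].
  by rewrite expr0 /= diracE mem_set// => -[].
rewrite /= /lebesgue_cons /pushforward.
rewrite (_ : _ @^-1` _ = `[(- r)%R, r]%classic `*` box r); last first.
  apply/seteqP; split => -[x t] /=.
    move=> h; split => [|i]; first by have := h ord0; rewrite tnth0 in_itv/= ler_norml.
    by have := h (lift ord0 i); rewrite tnthS.
  move=> [/= + h] i; rewrite in_itv/= -ler_norml => hx.
  by case: (unliftP ord0 i) => [j|] ->; rewrite ?tnth0 ?tnthS.
rewrite product_measure1E//; last exact: measurable_box.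
rewrite [X in _ * X]IH [X in X * _](lebesgue_measure_itv `[(- r)%R, r])/= lte_fin.
case: ifPn => [_|]; first by rewrite -EFinD -EFinM exprS; congr (EFin (_ * _)%R); lra.
rewrite -leNgt => rN; have -> : r = 0%R by lra.
by rewrite mulr0 exprS mul0r mul0e.
Qed.

(** * Uniqueness of translation-invariant measures and linear changes of variables *)

Lemma translate_addA n (c d : 'rV[R]_n) (x : T n) :
  translate c (translate d x) = translate (d + c) x.
Proof. by rewrite /translate tuple_of_rowK addrA. Qed.

Lemma translate0 n (x : T n) : translate 0 x = x.
Proof. by rewrite /translate addr0 row_ofK. Qed.

Lemma measurable_translate2 d (X : measurableType d) n (f g : X -> T n) :
  measurable_fun [set: X] f -> measurable_fun [set: X] g ->
  measurable_fun [set: X] (fun x => translate (row_of (f x)) (g x)).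
Proof.
move=> mf mg; have := measurable_affine2 1%:M 1%:M 0%R mg mf.
by under eq_fun do rewrite /affine2 !mulmx1 addr0.
Qed.

Lemma linear_mapN1 n (x : T n) : row_of (linear_map (- 1%:M)%R x) = (- row_of x)%R.
Proof. by rewrite tuple_of_rowK mulmxN mulmx1. Qed.

Lemma EFin_indic_ge0 (X : Type) (A : set X) x : 0 <= (\1_A x : R)%:E.
Proof. by rewrite lee_fin indicE. Qed.

Lemma measurable_EFin_indic d (X : measurableType d) (A : set X) :
  measurable A -> measurable_fun setT (fun x => (\1_A x : R)%:E).
Proof. by move=> mA; apply/measurable_EFinP; exact: measurable_indic. Qed.

Lemma measureEintegral d (X : measurableType d) (m : {measure set X -> \bar R})
    (A : set X) : measurable A -> m A = \int[m]_x (\1_A x : R)%:E.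
Proof. by move=> mA; rewrite integral_indic// setIT. Qed.

(* Both sides of Tonelli's theorem for [f y * g (Phi x + y)]: translating in [x] gives
   one product, translating in [y] the other. *)
Lemma invariant_integral_swap d (X : measurableType d)
    (m : {sigma_finite_measure set X -> \bar R}) n (Phi : X -> T n)
    (f g : T n -> \bar R) :
  measurable_fun setT Phi ->
  (forall (h : T n -> \bar R) c, measurable_fun setT h -> (forall x, 0 <= h x) ->
    \int[m]_x h (translate c (Phi x)) = \int[m]_x h (Phi x)) ->
  measurable_fun setT f -> (forall x, 0 <= f x) ->
  measurable_fun setT g -> (forall x, 0 <= g x) ->
  \int[lam n]_y f y * \int[m]_x g (Phi x) =
  \int[lam n]_y g y * \int[m]_x f (linear_map (- 1%:M)%R (Phi x)).
Proof.
move=> mPhi inv mf f0 mg g0.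
have mgPhi : measurable_fun setT (g \o Phi) by exact: (measurableT_comp mg mPhi).
have mN : measurable_fun setT (fun x => linear_map (- 1%:M)%R (Phi x)).
  exact: (measurableT_comp (measurable_linear_map _) mPhi).
have mfN : measurable_fun setT (f \o (fun x => linear_map (- 1%:M)%R (Phi x))).
  exact: (measurableT_comp mf mN).
transitivity (\int[lam n]_y \int[m]_x (f y * g (translate (row_of y) (Phi x)))).
  rewrite -ge0_integralZr//; last by apply: integral_ge0.
  apply: eq_integral => y _; rewrite ge0_integralZl//; first by rewrite inv.
  apply: (measurableT_comp mg).
  exact: (measurableT_comp (measurable_translate _) mPhi).
have mF : measurable_fun setT
    (fun z : X * T n => f z.2 * g (translate (row_of z.2) (Phi z.1))).
  apply: emeasurable_funM; first exact: (measurableT_comp mf measurable_snd).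
  apply: (measurableT_comp mg); apply: measurable_translate2 => //.
  exact: (measurableT_comp mPhi measurable_fst).
have F0 (z : X * T n) : 0 <= f z.2 * g (translate (row_of z.2) (Phi z.1)).
  exact: mule_ge0.
rewrite -(fubini_tonelli _ mF F0)/=.
have mG : measurable_fun setT (fun z : X * T n =>
    f (translate (- row_of (Phi z.1))%R z.2) * g z.2).
  apply: emeasurable_funM; last exact: (measurableT_comp mg measurable_snd).
  apply: (measurableT_comp mf).
  under eq_fun do rewrite -linear_mapN1.
  apply: measurable_translate2 => //.
  exact: (measurableT_comp mN measurable_fst).
have G0 (z : X * T n) : 0 <= f (translate (- row_of (Phi z.1))%R z.2) * g z.2.
  exact: mule_ge0.
transitivity (\int[m]_x \int[lam n]_y (f (translate (- row_of (Phi x))%R y) * g y)).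
  apply: eq_integral => x _.
  rewrite -(ge0_integral_translate (row_of (Phi x)))//.
  - apply: eq_integral => y _; rewrite translate_addA subrr translate0.
    by congr (_ * g _); rewrite /translate addrC.
  - exact: (measurableT_comp mG (measurable_pair1 x)).
  - by move=> y; exact: mule_ge0.
rewrite (fubini_tonelli _ mG G0)/= -ge0_integralZr//; last by apply: integral_ge0.
apply: eq_integral => y _; rewrite muleC -ge0_integralZr//.
  rewrite -(inv (fun z => f (linear_map (- 1%:M)%R z) * g y) (- row_of y)%R).
  - apply: eq_integral => x _; congr (f _ * _).
    by rewrite /linear_map /translate tuple_of_rowK mulmxN mulmx1 opprD opprK addrC.
  - apply: emeasurable_funM => //.
    exact: (measurableT_comp mf (measurable_linear_map _)).
  - by move=> z; exact: mule_ge0.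
Qed.

(** Take [f] in [invariant_integral_swap] to be the indicator of the unit box. It is invariant under
    negation, so the right side is the integral of [g] times the mass of the preimage of the box,
    and [c] is that mass divided by the volume 2^n of the box. *)
Lemma invariant_integral_proportional d (X : measurableType d)
    (m : {sigma_finite_measure set X -> \bar R}) n (Phi : X -> T n) :
  measurable_fun setT Phi ->
  (forall (h : T n -> \bar R) c, measurable_fun setT h -> (forall x, 0 <= h x) ->
    \int[m]_x h (translate c (Phi x)) = \int[m]_x h (Phi x)) ->
  m (Phi @^-1` box 1) < +oo -> 0 < m setT ->
  exists2 c : R, (0 < c)%R & forall g : T n -> \bar R,
    measurable_fun setT g -> (forall x, 0 <= g x) ->
    \int[m]_x g (Phi x) = c%:E * \int[lam n]_y g y.
Proof.
move=> mPhi inv foo mgt0.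
pose f (x : T n) : \bar R := (\1_(box 1) x : R)%:E.
have mf : measurable_fun setT f by apply: measurable_EFin_indic; exact: measurable_box.
have f0 x : 0 <= f x by exact: EFin_indic_ge0.
have fN x : f (linear_map (- 1%:M)%R x) = f x.
  rewrite /f !indicE; congr (_%:R%:E)%R; congr (nat_of_bool _).
  apply/idP/idP; rewrite !inE => h i; have := h i;
    by rewrite /linear_map tnth_mktuple mulmxN mulmx1 mxE normrN mxE.
have mQ : measurable (Phi @^-1` box 1).
  by rewrite -[X in measurable X]setTI; apply: mPhi => //; exact: measurable_box.
have fE : \int[lam n]_y f y = ((2 ^+ n)%R)%:E.
  transitivity (lam n (box 1)); last by rewrite lebesgue_tuple_box// mulr1.
  by rewrite (measureEintegral _ (measurable_box 1)).
have fPhiE : \int[m]_x f (Phi x) = m (Phi @^-1` box 1).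
  rewrite (_ : (fun x => f (Phi x)) = (fun x => (\1_(Phi @^-1` box 1) x : R)%:E))//.
  by rewrite -measureEintegral.
have key g : measurable_fun setT g -> (forall x, 0 <= g x) ->
    \int[m]_x g (Phi x) = (2 ^- n)%R%:E * m (Phi @^-1` box 1) * \int[lam n]_y g y.
  move=> mg g0; have := invariant_integral_swap mPhi inv mf f0 mg g0.
  under [X in _ = _ * X -> _]eq_integral do rewrite fN.
  rewrite fPhiE fE => /(congr1 (fun z => (2 ^- n)%R%:E * z)).
  rewrite muleA -EFinM mulVf ?expf_neq0// mul1e => ->.
  by rewrite [X in _ * X]muleC muleA.
have mPfin : m (Phi @^-1` box 1) \is a fin_num by rewrite ge0_fin_numE.
exists (2 ^- n * fine (m (Phi @^-1` box 1)))%R; last first.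
  by move=> g mg g0; rewrite key// EFinM fineK.
rewrite mulr_gt0 ?invr_gt0 ?exprn_gt0// fine_gt0// foo andbT lt0e measure_ge0 andbT.
(* If the constant were zero, the test function 1 would give [m] total mass zero. *)
apply/eqP => mP0; move: mgt0.
have := key (cst 1) (measurable_cst _) (fun=> lee01).
by rewrite mP0 mule0 mul0e integral_cst// mul1e => ->; rewrite ltxx.
Qed.

Definition mx_norm1 a b (M : 'M[R]_(a, b)) : R := \sum_i \sum_j `|M i j|%R.

Lemma mx_norm1_ge0 a b (M : 'M[R]_(a, b)) : (0 <= mx_norm1 M)%R.
Proof. by do 2!apply: sumr_ge0 => ? _. Qed.

Lemma row_mul_le a b (M : 'M[R]_(a, b)) (v : 'rV[R]_a) (r : R) i : (0 <= r)%R ->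
  (forall k, `|v ord0 k| <= r)%R -> (`|(v *m M) ord0 i| <= r * mx_norm1 M)%R.
Proof.
move=> r0 vr; rewrite mxE (le_trans (ler_norm_sum _ _ _))//.
rewrite /mx_norm1 mulr_sumr ler_sum// => k _; rewrite normrM ler_pM//.
by rewrite (bigD1 i)//= lerDl sumr_ge0.
Qed.

Lemma box_linear_map a b (M : 'M[R]_(a, b)) r x : (0 <= r)%R ->
  box r x -> box (r * mx_norm1 M) (linear_map M x).
Proof.
move=> r0 xr i; rewrite tnth_mktuple; apply: row_mul_le => // k.
by rewrite mxE.
Qed.

(** The rows of [V] and [W] together form a basis of the space, and [G], [K] read off the
    coordinates along each: the block row of [G] and [K] is the two-sided inverse of [V] stacked on
    [W]. *)
Definition split_basis a b n (V : 'M[R]_(a, n)) (W : 'M[R]_(b, n))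
    (G : 'M[R]_(n, a)) (K : 'M[R]_(n, b)) :=
  [/\ V *m G = 1%:M, V *m K = 0, W *m G = 0, W *m K = 1%:M & G *m V + K *m W = 1%:M]%R.

Lemma box_exhausts n (x : T n) : exists k0 : nat, forall k, (k0 <= k)%N -> box k%:R x.
Proof.
have [k0 xk0] : exists k : nat, (\sum_i `|tnth x i| <= k%:R)%R.
  by exists (Num.truncn (\sum_i `|tnth x i|)%R).+1; rewrite ltW// truncnS_gt.
exists k0 => k k0k i; apply: le_trans (le_trans xk0 _); last by rewrite ler_nat.
by rewrite (bigD1 i)//= lerDl sumr_ge0.
Qed.

(* The library's sigma-finite instance on [product_measure1] is shadowed by its
   subprobability instance, hence this copy of the product. *)
Definition lebesgue_pair a b : set (T a * T b) -> \bar R := lam a \x lam b.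

HB.instance Definition _ a b := Measure.on (@lebesgue_pair a b).

Let lebesgue_pair_sigma_finite a b : sigma_finite setT (@lebesgue_pair a b).
Proof.
exists (fun k => box k%:R `*` box k%:R).
  apply/seteqP; split => // -[x y] _.
  have [k1 xk] := box_exhausts x; have [k2 yk] := box_exhausts y.
  by exists (maxn k1 k2) => //; split => /=; [apply: xk|apply: yk];
    rewrite ?leq_maxl ?leq_maxr.
move=> k; split; first by apply: measurableX; exact: measurable_box.
rewrite /lebesgue_pair product_measure1E; [|exact: measurable_box..].
by rewrite [X in X * _]lebesgue_tuple_box// [X in _ * X]lebesgue_tuple_box// -EFinM ltry.
Qed.

HB.instance Definition _ a b := @Measure_isSigmaFinite.Build _ _ _ (@lebesgue_pair a b)
  (@lebesgue_pair_sigma_finite a b).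

(** Translating by [c] in the large space shifts [x] by [c *m G] and [y] by [c *m K], so the image
    of the product measure is translation invariant and hence a multiple of Lebesgue measure. The
    constant is the absolute value of a determinant, but only its positivity is recorded. *)
Lemma ge0_integral_split a b n (V : 'M[R]_(a, n)) (W : 'M[R]_(b, n))
    (G : 'M[R]_(n, a)) (K : 'M[R]_(n, b)) :
  split_basis V W G K ->
  exists2 c : R, (0 < c)%R & forall f : T n -> \bar R,
    measurable_fun setT f -> (forall x, 0 <= f x) ->
    \int[lam n]_z f z = c%:E * \int[lam b]_y \int[lam a]_x f (affine2 V W 0 x y).
Proof.
case=> VG VK WG WK GK.
pose Phi (z : T a * T b) := affine2 V W 0%R z.1 z.2.
have mPhi : measurable_fun setT Phi by exact: measurable_affine2.
have [||||c c0 cE] := @invariant_integral_proportional _ _ (@lebesgue_pair a b) n Phi.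
- exact: mPhi.
- move=> h c mh h0.
  pose h1 c z := h (translate c (Phi z)).
  have mh1 c' : measurable_fun setT (h1 c').
    apply: (measurableT_comp mh); exact: (measurableT_comp (measurable_translate _) mPhi).
  have h10 c' z : 0 <= h1 c' z by exact: h0.
  have h1E : (fun z => h (Phi z)) = h1 0%R by apply/funext => z; rewrite /h1 translate0.
  rewrite h1E [LHS](fubini_tonelli1 _ (mh1 c) (h10 c)).
  rewrite [RHS](fubini_tonelli1 _ (mh1 0%R) (h10 0%R)).
  have mF := measurable_fun_fubini_tonelli_F _ (mh1 0%R) (h10 0%R).
  rewrite -[RHS](ge0_integral_translate (c *m G)).
  + apply: eq_integral => x _; rewrite /fubini_F.
    rewrite -[RHS](ge0_integral_translate (c *m K)).
    * apply: eq_integral => y _; rewrite /h1 translate0; congr h.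
      rewrite /Phi /affine2 /translate !tuple_of_rowK !addr0 !mulmxDl.
      rewrite addrACA; congr (tuple_of_row (_ + _)).
      by rewrite -!mulmxA -mulmxDr GK mulmx1.
    * exact: (measurableT_comp (mh1 0%R) (measurable_pair1 _)).
    * by move=> y; exact: h10.
  + exact: mF.
  + by move=> x; apply: integral_ge0 => y _; exact: h10.
- apply: (@le_lt_trans _ _ ((lam a \x lam b) (box (1 * mx_norm1 G) `*` box (1 * mx_norm1 K)))).
    apply: le_measure; rewrite ?inE.
    + by rewrite -[X in measurable X]setTI; apply: mPhi => //; exact: measurable_box.
    + by apply: measurableX; exact: measurable_box.
    + move=> [x y] /= h; split => /=.
        rewrite (_ : x = linear_map G (Phi (x, y))); first exact: box_linear_map.
        rewrite /linear_map /Phi /affine2 tuple_of_rowK addr0 mulmxDl -!mulmxA.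
        by rewrite VG WG mulmx1 mulmx0 addr0 row_ofK.
      rewrite (_ : y = linear_map K (Phi (x, y))); first exact: box_linear_map.
      rewrite /linear_map /Phi /affine2 tuple_of_rowK addr0 mulmxDl -!mulmxA.
      by rewrite VK WK mulmx1 mulmx0 add0r row_ofK.
  rewrite product_measure1E; [|exact: measurable_box..].
  rewrite [X in X * _]lebesgue_tuple_box ?mul1r ?mx_norm1_ge0//.
  by rewrite [X in _ * X]lebesgue_tuple_box ?mul1r ?mx_norm1_ge0// -EFinM ltry.
- apply: (@lt_le_trans _ _ ((lam a \x lam b) (box 1 `*` box 1))).
    rewrite product_measure1E; [|exact: measurable_box..].
    rewrite [X in X * _]lebesgue_tuple_box// [X in _ * X]lebesgue_tuple_box//.
  apply: le_measure; rewrite ?inE//; apply: measurableX; exact: measurable_box.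
exists c^-1%R; first by rewrite invr_gt0.
move=> f mf f0; rewrite -(fubini_tonelli2 (f \o Phi)); last 2 first.
- exact: (measurableT_comp mf mPhi).
- by move=> z; exact: f0.
by rewrite cE// muleA -EFinM mulVf ?gt_eqF// mul1e.
Qed.

(** A cube in place of the unit ball of H_0: it contains the ball, which is what sufficiency asks
    for. The shift [c] arises when the cut-off is restricted to a fibre. *)
Definition cut n k (L0 : 'M[R]_(n, k)) (c : 'rV[R]_k) : set (T n) :=
  [set x | box 1 (tuple_of_row (row_of x *m L0 + c))].

Lemma measurable_cut n k (L0 : 'M[R]_(n, k)) (c : 'rV[R]_k) : measurable (cut L0 c).
Proof.
rewrite -[X in measurable X]setTI.
have mt : measurable_fun setT (fun x : T n => translate c (linear_map L0 x)).
  exact: (measurableT_comp (measurable_translate _) (measurable_linear_map _)).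
have := mt measurableT _ (measurable_box (n := k) 1).
rewrite (_ : _ @^-1` _ = cut L0 c)//; apply/seteqP; split => x /=;
  by rewrite /cut /= /translate /linear_map tuple_of_rowK.
Qed.

Lemma lebesgue_tuple_translate n (c : 'rV[R]_n) (A : set (T n)) :
  measurable A -> lam n (translate c @^-1` A) = lam n A.
Proof.
move=> mA; have mcA : measurable (translate c @^-1` A).
  by rewrite -[X in measurable X]setTI; exact: measurable_translate.
rewrite !measureEintegral// -[RHS](ge0_integral_translate c)//; exact: measurable_EFin_indic.
Qed.

(** The point [x] is recovered, up to the shift [c *m K], by applying [K] to a point of the unit
    box. So each cut lies in a translate of one fixed box, and the bound is uniform in [c]. *)
Lemma cut_volume n k (L0 : 'M[R]_(n, k)) (K : 'M[R]_(k, n)) : L0 *m K = 1%:M ->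
  exists2 C : R, (0 <= C)%R & forall c, lam n (cut L0 c) <= C%:E.
Proof.
move=> LK; exists ((2 * mx_norm1 K) ^+ n)%R.
  by rewrite exprn_ge0// mulr_ge0// mx_norm1_ge0.
move=> c; rewrite -lebesgue_tuple_box ?mx_norm1_ge0//.
rewrite -(lebesgue_tuple_translate (c *m K) (measurable_box _)).
apply: le_measure; rewrite ?inE.
- exact: measurable_cut.
- by rewrite -[X in measurable X]setTI; apply: measurable_translate => //; exact: measurable_box.
- move=> x /(box_linear_map K ler01); rewrite mul1r.
  by rewrite /linear_map tuple_of_rowK mulmxDl -mulmxA LK mulmx1.
Qed.

(** * Interpolation and factorization of localized Brascamp-Lieb bounds *)

Lemma poweRD_ge0 (x : \bar R) r s : (0 <= r)%R -> (0 <= s)%R ->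
  x `^ (r + s) = x `^ r * x `^ s.
Proof.
move=> r0 s0; have [rs|rs] := eqVneq (r + s)%R 0%R; last first.
  by rewrite poweRD// add_neq0_poweRD_def.
have -> : r = 0%R by lra.
have -> : s = 0%R by lra.
by rewrite addr0 !poweRe0 mule1.
Qed.

Lemma poweR_prod (I : finType) (x : I -> \bar R) r : (forall i, 0 <= x i) ->
  (\prod_i x i) `^ r = \prod_i (x i `^ r).
Proof.
move=> x0; have H : 0 <= \prod_i x i /\ (\prod_i x i) `^ r = \prod_i (x i `^ r).
  apply: (big_rec2 (fun a b => 0 <= a /\ a `^ r = b)); first by rewrite poweR1r.
  by move=> i a b _ [a0 <-]; rewrite poweRM// mule_ge0.
by case: H.
Qed.

Lemma eprod_ge0 (I : Type) (r : seq I) (P : pred I) (x : I -> \bar R) :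
  (forall i, P i -> 0 <= x i) -> 0 <= \prod_(i <- r | P i) x i.
Proof. by move=> x0; elim/big_ind: _ => // a b; exact: mule_ge0. Qed.

Lemma mem_itv0y (x : \bar R) : 0 <= x -> x \in `[0, +oo].
Proof. by move=> x0; rewrite in_itv; apply/andP; split => //; exact: leey. Qed.

Lemma poweR_mean_le (x y : \bar R) th : 0 <= x -> 0 <= y ->
  (0 <= th)%R -> (th <= 1)%R -> x `^ th * y `^ (1 - th) <= x + y.
Proof.
move=> x0 y0 t0 t1; have t1' : (0 <= 1 - th)%R by lra.
have E : 1%R = (th + (1 - th))%R by lra.
have I := @mem_itv0y.
have [xy|/ltW yx] := leP x y.
  apply: (@le_trans _ _ y); last by rewrite leeDr.
  rewrite -[leRHS]poweRe1// [X in _ <= _ `^ X]E [leRHS]poweRD_ge0//.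
  by apply: lee_wpmul2r; [exact: poweR_ge0|apply: gt0_ler_poweR => //; exact: I].
apply: (@le_trans _ _ x); last by rewrite leeDl.
rewrite -[leRHS]poweRe1// [X in _ <= _ `^ X]E [leRHS]poweRD_ge0//.
by apply: lee_wpmul2l; [exact: poweR_ge0|apply: gt0_ler_poweR => //; exact: I].
Qed.

Lemma ge0_integral_eq0_ae d (X : measurableType d) (m : {measure set X -> \bar R})
    (D : set X) (f g : X -> \bar R) :
  measurable D -> measurable_fun D f -> measurable_fun D g ->
  (forall x, 0 <= f x) -> (forall x, 0 <= g x) ->
  (forall x, f x = 0 -> g x = 0) ->
  \int[m]_(x in D) f x = 0 -> \int[m]_(x in D) g x = 0.
Proof.
move=> mD mf mg f0 g0 fg If0.
have : \int[m]_(x in D) `|f x| = 0.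
  by rewrite -[RHS]If0; apply: eq_integral => x _; rewrite gee0_abs.
move=> /(ae_eq_integral_abs m mD mf) fae.
have : \int[m]_(x in D) `|g x| = 0.
  apply/(ae_eq_integral_abs m mD mg); apply: filterS fae => x + Dx => /(_ Dx).
  exact: fg.
by move=> <-; apply: eq_integral => x _; rewrite gee0_abs.
Qed.

(* Hoelder's inequality with the constant 2, which suffices for interpolation and
   follows from the trivial bound of a geometric mean by a sum. *)
Lemma hoelder_le2 d (X : measurableType d) (m : {measure set X -> \bar R})
    (D : set X) (f g : X -> \bar R) th :
  measurable D -> measurable_fun D f -> measurable_fun D g ->
  (forall x, 0 <= f x) -> (forall x, 0 <= g x) ->
  (0 <= th)%R -> (th <= 1)%R ->
  \int[m]_(x in D) (f x `^ th * g x `^ (1 - th)) <=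
  2%:E * ((\int[m]_(x in D) f x) `^ th * (\int[m]_(x in D) g x) `^ (1 - th)).
Proof.
move=> mD mf mg f0 g0 t0 t1.
have If0 : 0 <= \int[m]_(x in D) f x by apply: integral_ge0.
have Ig0 : 0 <= \int[m]_(x in D) g x by apply: integral_ge0.
have mp (h : X -> \bar R) r : measurable_fun D h -> measurable_fun D (fun x => h x `^ r).
  by move=> mh; exact: (measurableT_comp (measurable_poweR _) mh).
have mfg : measurable_fun D (fun x => f x `^ th * g x `^ (1 - th)).
  by apply: emeasurable_funM; exact: mp.
have fg0 x : 0 <= f x `^ th * g x `^ (1 - th) by rewrite mule_ge0// poweR_ge0.
have [th0|th0] := eqVneq th 0%R.
  rewrite th0 subr0 poweRe0 mul1e poweRe1//.
  under eq_integral do rewrite poweRe0 mul1e poweRe1//.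
  by rewrite lee_pemull// lee1n.
have [th1|th1] := eqVneq th 1%R.
  rewrite th1 subrr poweRe0 mule1 poweRe1//.
  under eq_integral do rewrite poweRe0 mule1 poweRe1//.
  by rewrite lee_pemull// lee1n.
have th1' : (1 - th)%R != 0%R by rewrite subr_eq0 eq_sym.
have RHS0 : 0 <= 2%:E * ((\int[m]_(x in D) f x) `^ th * (\int[m]_(x in D) g x) `^ (1 - th)).
  by rewrite !mule_ge0// ?poweR_ge0.
have [If00|Ifn0] := eqVneq (\int[m]_(x in D) f x) 0.
  rewrite (@ge0_integral_eq0_ae _ _ _ _ f)// => x fx0.
  by rewrite fx0 poweR0r// mul0e.
have [Ig00|Ign0] := eqVneq (\int[m]_(x in D) g x) 0.
  rewrite (@ge0_integral_eq0_ae _ _ _ _ g)// => x gx0.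
  by rewrite gx0 poweR0r// mule0.
have Ifgt0 : 0 < \int[m]_(x in D) f x by rewrite lt0e Ifn0.
have Iggt0 : 0 < \int[m]_(x in D) g x by rewrite lt0e Ign0.
have [Ify|Ify] := eqVneq (\int[m]_(x in D) f x) +oo.
  by rewrite Ify poweRyr// gt0_mulye ?poweR_gt0// gt0_muley// leey.
have [Igy|Igy] := eqVneq (\int[m]_(x in D) g x) +oo.
  by rewrite Igy poweRyr// gt0_muley ?poweR_gt0// gt0_muley// leey.
have /fineK If : (\int[m]_(x in D) f x) \is a fin_num by rewrite ge0_fin_numE// ltey.
have /fineK Ig : (\int[m]_(x in D) g x) \is a fin_num by rewrite ge0_fin_numE// ltey.
set a := fine _ in If; set b := fine _ in Ig.
have a0 : (0 < a)%R by rewrite -lte_fin If.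
have b0 : (0 < b)%R by rewrite -lte_fin Ig.
(* From here both functions are normalized to integral 1; the sum that bounds their geometric mean
   then has integral 2. *)
have nf : \int[m]_(x in D) (a^-1%:E * f x) = 1.
  by rewrite ge0_integralZl//= -?If -?EFinM ?mulVf ?gt_eqF// lee_fin invr_ge0 ltW.
have ng : \int[m]_(x in D) (b^-1%:E * g x) = 1.
  by rewrite ge0_integralZl//= -?Ig -?EFinM ?mulVf ?gt_eqF// lee_fin invr_ge0 ltW.
have nf0 x : 0 <= a^-1%:E * f x by rewrite mule_ge0// lee_fin invr_ge0 ltW.
have ng0 x : 0 <= b^-1%:E * g x by rewrite mule_ge0// lee_fin invr_ge0 ltW.
rewrite -If -Ig.
have E x : f x `^ th * g x `^ (1 - th) = a%:E `^ th * b%:E `^ (1 - th) *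
    ((a^-1%:E * f x) `^ th * (b^-1%:E * g x) `^ (1 - th)).
  rewrite muleACA -!poweRM ?lee_fin ?(ltW a0) ?(ltW b0)//.
  by rewrite !muleA -!EFinM !mulfV ?gt_eqF// !mul1e.
under eq_integral do rewrite E.
rewrite ge0_integralZl//; last 3 first.
- by apply: emeasurable_funM; apply: mp; exact: measurable_funeM.
- by move=> x _; rewrite mule_ge0// poweR_ge0.
- by rewrite mule_ge0// poweR_ge0.
rewrite [leRHS]muleC; apply: lee_wpmul2l; first by rewrite mule_ge0// poweR_ge0.
apply: (@le_trans _ _ (\int[m]_(x in D) (a^-1%:E * f x + b^-1%:E * g x))).
  apply: ge0_le_integral_nomeas => x _; first by rewrite mule_ge0// poweR_ge0.
  exact: poweR_mean_le.
rewrite ge0_integralD//; [|exact: measurable_funeM..].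
by rewrite nf ng -EFinD.
Qed.

(* The exponent [s j] stands for [1 / p_j] and [f j] for the [p_j]-th power of the function
   of the theorem; [s j = 0] encodes [p_j = oo], as [x `^ 0 = 1] for all [x].  Uniformity in
   the translate [c] of the cut-off is what lets the bound pass to the fibres of a
   factorization. *)
Definition bl_bound n k m (nj : 'I_m -> nat) (L0 : 'M[R]_(n, k))
    (L : forall j, 'M[R]_(n, nj j)) (s : 'I_m -> R) : Prop :=
  exists2 C : R, (0 <= C)%R & forall (c : 'rV[R]_k) (f : forall j, T (nj j) -> \bar R),
    (forall j, measurable_fun setT (f j)) -> (forall j x, 0 <= f j x) ->
    \int[lam n]_(x in cut L0 c) \prod_j (f j (linear_map (L j) x)) `^ s j <=
    C%:E * \prod_j (\int[lam (nj j)]_x f j x) `^ s j.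

Lemma emeasurable_prod d (X : measurableType d) (D : set X) (I : finType)
    (h : I -> X -> \bar R) : (forall i, measurable_fun D (h i)) ->
  measurable_fun D (fun x => \prod_i h i x).
Proof.
move=> mh; elim: (index_enum I) => [|i s IH].
  by under eq_fun do rewrite big_nil; exact: measurable_cst.
under eq_fun do rewrite big_cons.
exact: emeasurable_funM.
Qed.

Lemma measurable_bl_integrand d (X : measurableType d) m (nj : 'I_m -> nat)
    (h : forall j, X -> T (nj j)) (s : 'I_m -> R) (f : forall j, T (nj j) -> \bar R) :
  (forall j, measurable_fun setT (f j)) -> (forall j, measurable_fun setT (h j)) ->
  measurable_fun setT (fun x => \prod_j (f j (h j x)) `^ s j).
Proof.
move=> mf mh; apply: emeasurable_prod => j.
apply: (measurableT_comp (measurable_poweR _)).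
exact: (measurableT_comp (mf j) (mh j)).
Qed.

(** With powers of the [f j] in place of the [f j], the same functions serve all exponents: the
    integrand for the mixed exponents is the geometric mean of the integrands for [s] and [s'], and
    so is the right side. One use of Hoelder's inequality for two functions suffices. *)
Lemma bl_bound_interpolate n k m (nj : 'I_m -> nat) (L0 : 'M[R]_(n, k))
    (L : forall j, 'M[R]_(n, nj j)) (s s' : 'I_m -> R) th :
  (forall j, (0 <= s j)%R) -> (forall j, (0 <= s' j)%R) -> (0 <= th)%R -> (th <= 1)%R ->
  bl_bound L0 L s -> bl_bound L0 L s' ->
  bl_bound L0 L (fun j => th * s j + (1 - th) * s' j)%R.
Proof.
move=> s0 s'0 t0 t1 [C C0 HC] [C' C'0 HC'].
have t1' : (0 <= 1 - th)%R by lra.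
have prodE (x : 'I_m -> \bar R) : (forall j, 0 <= x j) ->
    \prod_j x j `^ (th * s j + (1 - th) * s' j) =
    (\prod_j x j `^ s j) `^ th * (\prod_j x j `^ s' j) `^ (1 - th).
  move=> x0; rewrite !poweR_prod ?(fun=> poweR_ge0 _ _)//; last 2 first.
  - by move=> j; exact: poweR_ge0.
  - by move=> j; exact: poweR_ge0.
  rewrite -big_split/=; apply: eq_bigr => j _.
  by rewrite poweRD_ge0 ?mulr_ge0// -!poweRrM ![(_ * th)%R]mulrC ![(_ * (1 - th))%R]mulrC.
exists (2 * (C `^ th * C' `^ (1 - th)))%R.
  by rewrite mulr_ge0// mulr_ge0// powR_ge0.
move=> c f mf f0.
have mD := measurable_cut L0 c.
have mF r : measurable_fun (cut L0 c) (fun x => \prod_j (f j (linear_map (L j) x)) `^ r j).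
  apply: measurable_funTS; apply: measurable_bl_integrand => // j.
  exact: measurable_linear_map.
have F0 r x : 0 <= \prod_j (f j (linear_map (L j) x)) `^ r j.
  by apply: eprod_ge0 => j _; exact: poweR_ge0.
have I0 j : 0 <= \int[lam (nj j)]_x f j x by apply: integral_ge0.
under eq_integral do rewrite prodE//.
apply: le_trans (hoelder_le2 _ mD (mF s) (mF s') (F0 s) (F0 s') t0 t1) _.
rewrite prodE// EFinM -muleA; apply: lee_wpmul2l; first by rewrite lee_fin.
rewrite EFinM -!poweR_EFin muleACA -!poweRM ?lee_fin//; last 2 first.
- by apply: eprod_ge0 => j _; exact: poweR_ge0.
- by apply: eprod_ge0 => j _; exact: poweR_ge0.
have I := @mem_itv0y.
have P0 r : 0 <= \prod_j (\int[lam (nj j)]_x f j x) `^ r j.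
  by apply: eprod_ge0 => j _; exact: poweR_ge0.
apply: lee_pmul; rewrite ?poweR_ge0//; apply: gt0_ler_poweR => //.
- by apply: I; exact: integral_ge0.
- by apply: I; rewrite mule_ge0.
- exact: HC.
- by apply: I; exact: integral_ge0.
- by apply: I; rewrite mule_ge0.
- exact: HC'.
Qed.

(** In adapted bases [L j] is block triangular: the point xV + yW goes to (x P_j + y A_j) V_j + (y
    D_j) W_j. For fixed [y] the inner inequality for [P] bounds the integral over the fibre by
    powers of [g j] at y D_j, where [g j] integrates [f j] over the fibres along [Vj j]; the outer
    inequality for [D] is then applied to the [g j]. The outer cut-off [M0] only has to contain the
    projection of the original one. *)
Lemma bl_bound_factor n k m (nj : 'I_m -> nat) (L0 : 'M[R]_(n, k))
    (L : forall j, 'M[R]_(n, nj j)) (s : 'I_m -> R) a b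
    (V : 'M[R]_(a, n)) (W : 'M[R]_(b, n)) G K (aj bj : 'I_m -> nat)
    (Vj : forall j, 'M[R]_(aj j, nj j)) (Wj : forall j, 'M[R]_(bj j, nj j))
    (Gj : forall j, 'M[R]_(nj j, aj j)) (Kj : forall j, 'M[R]_(nj j, bj j))
    (P : forall j, 'M[R]_(a, aj j)) (A : forall j, 'M[R]_(b, aj j))
    (D : forall j, 'M[R]_(b, bj j)) (M0 : 'M[R]_(b, k)) :
  split_basis V W G K -> (forall j, split_basis (Vj j) (Wj j) (Gj j) (Kj j)) ->
  (forall j, (0 <= s j)%R) ->
  (forall j, V *m L j = P j *m Vj j) ->
  (forall j, W *m L j = A j *m Vj j + D j *m Wj j)%R ->
  (forall c, exists c', forall x y, cut L0 c (affine2 V W 0 x y) -> cut M0 c' y) ->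
  bl_bound (V *m L0) P s -> bl_bound M0 D s -> bl_bound L0 L s.
Proof.
move=> spVW spj s0 VL WL cutW [C1 C10 H1] [C2 C20 H2].
have [c0 c00 Hc0] := ge0_integral_split spVW.
have /choice[cj Hcj] : forall j, exists c : R, (0 < c)%R /\ forall f : T (nj j) -> \bar R,
    measurable_fun setT f -> (forall x, 0 <= f x) ->
    \int[lam (bj j)]_y \int[lam (aj j)]_x f (affine2 (Vj j) (Wj j) 0 x y) =
    c%:E * \int[lam (nj j)]_z f z.
  move=> j; have [c cgt0 Hc] := ge0_integral_split (spj j).
  exists c^-1%R; split; first by rewrite invr_gt0.
  by move=> f mf f0; rewrite Hc// muleA -EFinM mulVf ?gt_eqF// mul1e.
exists (c0 * C1 * C2 * \prod_j (cj j `^ s j))%R.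
  by rewrite !mulr_ge0// ?(ltW c00)// prodr_ge0// => j _; exact: powR_ge0.
move=> c f mf f0.
have mD := measurable_cut L0 c.
pose F x := \prod_j (f j (linear_map (L j) x)) `^ s j.
have mF : measurable_fun setT F.
  by apply: measurable_bl_integrand => // j; exact: measurable_linear_map.
have F0 x : 0 <= F x by apply: eprod_ge0 => j _; exact: poweR_ge0.
rewrite integral_mkcond Hc0; last 2 first.
- by apply/(measurable_restrictT _ mD); exact: measurable_funTS.
- by move=> x; apply: erestrict_ge0 => y _; exact: F0.
have [c' Hc'] := cutW c.
pose g j (w : T (bj j)) := \int[lam (aj j)]_u f j (affine2 (Vj j) (Wj j) 0 u w).
have mfj j : measurable_fun setT
    (fun z : T (aj j) * T (bj j) => f j (affine2 (Vj j) (Wj j) 0 z.1 z.2)).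
  by apply: (measurableT_comp (mf j)); exact: measurable_affine2.
have mg j : measurable_fun setT (g j).
  exact: (measurable_fun_fubini_tonelli_G _ (mfj j) (fun=> f0 _ _)).
have g0 j w : 0 <= g j w by apply: integral_ge0.
pose Gy (y : T b) := \prod_j (g j (linear_map (D j) y)) `^ s j.
have mGy : measurable_fun setT Gy.
  by apply: measurable_bl_integrand => // j; exact: measurable_linear_map.
have Gy0 y : 0 <= Gy y by apply: eprod_ge0 => j _; exact: poweR_ge0.
(* Over a point outside [cut M0 c'] the fibre does not meet the cut-off, so the integral is zero;
   otherwise the inner inequality applies with a cut-off shifted by [y]. *)
have inner (y : T b) : \int[lam a]_x (F \_ (cut L0 c)) (affine2 V W 0 x y) <=
    ((fun y => C1%:E * Gy y) \_ (cut M0 c')) y.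
  rewrite [leRHS]patchE; case: ifPn => yc; last first.
    rewrite integral0_eq// => x _; rewrite patchE; case: ifPn => // xc.
    by move: yc; rewrite notin_setE => -[]; apply: (Hc' x); rewrite inE in xc.
  have -> : \int[lam a]_x (F \_ (cut L0 c)) (affine2 V W 0 x y) =
      \int[lam a]_(x in cut (V *m L0) (row_of y *m W *m L0 + c))
        \prod_j (f j (affine2 (Vj j) (Wj j) 0
          (translate (row_of y *m A j) (linear_map (P j) x)) (linear_map (D j) y))) `^ s j.
    rewrite [RHS]integral_mkcond; apply: eq_integral => x _.
    rewrite !patchE; have -> : (affine2 V W 0 x y \in cut L0 c) =
        (x \in cut (V *m L0) (row_of y *m W *m L0 + c)).
      apply/idP/idP; rewrite !inE /cut/= /affine2 tuple_of_rowK addr0 mulmxDl;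
        by rewrite !addrA mulmxA.
    case: ifPn => // _; apply: eq_bigr => j _; congr (f j _ `^ _).
    rewrite /linear_map /affine2 /translate !tuple_of_rowK !addr0; congr tuple_of_row.
    by rewrite !mulmxDl -!mulmxA VL WL mulmxDr !mulmxA addrA.
  apply: le_trans (H1 _ (fun j u => f j (affine2 (Vj j) (Wj j) 0
    (translate (row_of y *m A j) u) (linear_map (D j) y))) _ _) _.
  - move=> j; apply: (measurableT_comp (mf j)); apply: measurable_affine2 => //.
    exact: measurable_translate.
  - by move=> j x; exact: f0.
  apply: lee_wpmul2l; first by rewrite lee_fin.
  rewrite /Gy le_eqVlt; apply/orP; left; apply/eqP; apply: eq_bigr => j _.
  congr (_ `^ _); rewrite /g.
  (* The off-diagonal block [A j] only translates the fibre, so it disappears from the integral. *)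
  rewrite (ge0_integral_translate (f := fun u => f j (affine2 (Vj j) (Wj j) 0 u (linear_map (D j) y))))//.
  exact: (measurableT_comp (mfj j) (measurable_pair2 _)).
apply: (@le_trans _ _ (c0%:E * (C1%:E * (C2%:E * \prod_j (cj j)%:E `^ s j *
    \prod_j (\int[lam (nj j)]_x f j x) `^ s j)))).
  apply: lee_wpmul2l; first by rewrite lee_fin ltW.
  apply: (@le_trans _ _ (\int[lam b]_y ((fun y => C1%:E * Gy y) \_ (cut M0 c')) y)).
    apply: ge0_le_integral_nomeas => y _; last exact: inner.
    by apply: integral_ge0 => x _; apply: erestrict_ge0 => z _; exact: F0.
  rewrite -integral_mkcond ge0_integralZl//; last 2 first.
  - exact: measurable_cut.
  - exact: measurable_funTS.
  apply: lee_wpmul2l; first by rewrite lee_fin.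
  apply: le_trans (H2 c' g mg g0) _.
  rewrite -muleA; apply: lee_wpmul2l; first by rewrite lee_fin.
  rewrite -big_split/= le_eqVlt; apply/orP; left; apply/eqP; apply: eq_bigr => j _.
  have [cj0 Hj] := Hcj j; rewrite /g Hj// poweRM ?lee_fin ?(ltW cj0)//.
  exact: integral_ge0.
under [X in _ * (_ * (_ * X * _)) <= _]eq_bigr do rewrite poweR_EFin.
by rewrite !EFinM -prodEFin !muleA.
Qed.

(** * Factorization through critical subspaces *)

(** A subspace is the row space of a matrix with any number of rows, and its image under [L j] is
    the row space of the product. Codimensions are real differences, which are never truncated. *)
Definition feasible n k m (nj : 'I_m -> nat) (L0 : 'M[R]_(n, k))
    (L : forall j, 'M[R]_(n, nj j)) (s : 'I_m -> R) : Prop :=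
  [/\ forall j, (0 <= s j <= 1)%R,
      forall u (V : 'M[R]_(u, n)), V *m L0 = 0%R ->
        ((\rank V)%:R <= \sum_j s j * (\rank (V *m L j))%:R)%R &
      forall u (V : 'M[R]_(u, n)),
        (\sum_j s j * ((nj j)%:R - (\rank (V *m L j))%:R) <= n%:R - (\rank V)%:R)%R].

Definition tight_ker n k m (nj : 'I_m -> nat) (L0 : 'M[R]_(n, k))
    (L : forall j, 'M[R]_(n, nj j)) (s : 'I_m -> R) u (V : 'M[R]_(u, n)) : Prop :=
  V *m L0 = 0%R /\ (\rank V)%:R = (\sum_j s j * (\rank (V *m L j))%:R)%R.

Definition tight_codim n m (nj : 'I_m -> nat)
    (L : forall j, 'M[R]_(n, nj j)) (s : 'I_m -> R) u (V : 'M[R]_(u, n)) : Prop :=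
  (\sum_j s j * ((nj j)%:R - (\rank (V *m L j))%:R))%R = (n%:R - (\rank V)%:R)%R.

(** The number of rows is [n] only up to a provable equality, so the inverse is taken with [pinvmx];
    [coord_in] and [coord_out] are its two blocks of columns. *)
Definition split_mx u n (V : 'M[R]_(u, n)) : 'M[R]_(\rank V + \rank V^C, n) :=
  col_mx (row_base V) (row_base V^C%MS).

Definition coord_in u n (V : 'M[R]_(u, n)) : 'M[R]_(n, \rank V) :=
  lsubmx (pinvmx (split_mx V)).

Definition coord_out u n (V : 'M[R]_(u, n)) : 'M[R]_(n, \rank V^C) :=
  rsubmx (pinvmx (split_mx V)).

Lemma rank_split_mx u n (V : 'M[R]_(u, n)) : \rank (split_mx V) = n.
Proof.
apply/eqP; rewrite -/(row_full _) /split_mx -sub1mx -addsmxE.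
have := addsmx_compl_full V; rewrite -sub1mx => /submx_trans; apply.
by apply: addsmxS; rewrite eq_row_base.
Qed.

Lemma split_mxP u n (V : 'M[R]_(u, n)) :
  split_basis (row_base V) (row_base V^C%MS) (coord_in V) (coord_out V).
Proof.
have rf : row_full (split_mx V) by apply/eqP; exact: rank_split_mx.
have rr : row_free (split_mx V).
  by apply/eqP; rewrite rank_split_mx mxrank_compl subnKC// rank_leq_col.
have := mulmxVp rr; have := mulVpmx rf.
rewrite -[pinvmx _]hsubmxK -/(coord_in V) -/(coord_out V) /split_mx mul_row_col => GK.
rewrite mul_col_row (scalar_mx_block (\rank V) (\rank V^C)) => /eq_block_mx[? ? ? ?].
by split.
Qed.

Section Split.
Variables (a b n : nat) (V : 'M[R]_(a, n)) (W : 'M[R]_(b, n)).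
Variables (G : 'M[R]_(n, a)) (K : 'M[R]_(n, b)).
Hypothesis sp : split_basis V W G K.

Lemma split_row_freel : row_free V.
Proof. by case: sp => VG _ _ _ _; apply/row_freeP; exists G. Qed.

Lemma split_row_freer : row_free W.
Proof. by case: sp => _ _ _ WK _; apply/row_freeP; exists K. Qed.

Lemma split_decomp u (X : 'M[R]_(u, n)) : X = (X *m G *m V + X *m K *m W)%R.
Proof. by case: sp => _ _ _ _ GK; rewrite -!mulmxA -mulmxDr GK mulmx1. Qed.

(** Modulo [V], the rows of [X] may be replaced by their components [X *m K *m W] along [W], which
    are independent of [V]. *)
Lemma rank_split u v (B : 'M[R]_(v, n)) (X : 'M[R]_(u, n)) : (B :=: V)%MS ->
  \rank (col_mx B X) = (a + \rank (X *m K))%N.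
Proof.
move=> BV; case: sp => VG VK WG WK GK.
rewrite -addsmxE (adds_eqmx BV (eqmx_refl _)).
have -> : \rank (V + X)%MS = \rank (V + X *m K *m W)%MS.
  apply/eqmx_rank/eqmxP/eqmxP => //; apply/andP; split; rewrite addsmx_sub addsmxSl/=.
    rewrite [X in (X <= _)%MS]split_decomp addmx_sub_adds// ?submxMl//.
  have -> : (X *m K *m W = X - X *m G *m V)%R.
    by rewrite [X in (X - _)%R]split_decomp addrC addKr.
  rewrite addmx_sub ?addsmxSr// eqmx_opp; apply: submx_trans (addsmxSl _ _).
  exact: submxMl.
rewrite mxrank_disjoint_sum.
  by rewrite (eqP split_row_freel) (mxrankMfree _ split_row_freer).
apply/eqP/rowV0P => v0; rewrite sub_capmx => /andP[/submxP[p ->] /submxP[q pq]].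
have := congr1 (mulmx^~ K) pq.
rewrite -!mulmxA VK WK !mulmx1 mulmx0 => qXK.
by rewrite pq !mulmxA -[(q *m X *m K)%R]mulmxA -qXK mul0mx.
Qed.

End Split.

Lemma sumsB (m : nat) (s x y : 'I_m -> R) :
  (\sum_j s j * (x j - y j) = \sum_j s j * x j - \sum_j s j * y j)%R.
Proof. by rewrite -sumrB; apply: eq_bigr => j _; rewrite mulrBr. Qed.

Section TightStep.
Variables (n k m : nat) (nj : 'I_m -> nat) (L0 : 'M[R]_(n, k)).
Variables (L : forall j, 'M[R]_(n, nj j)) (s : 'I_m -> R).
Hypothesis feas : feasible L0 L s.
Variables (u : nat) (V : 'M[R]_(u, n)).

(** Bases adapted to [V] and to its images. [P j] is the restriction of [L j] to a map from V to L_j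
    V, and [D j] is the map that [L j] induces from H/V to H_j/(L_j V). *)
Let Vb := row_base V.
Let Wb := row_base V^C%MS.
Let Vj j := row_base (V *m L j).
Let Wj j := row_base (V *m L j)^C%MS.
Let P j := Vb *m L j *m coord_in (V *m L j).
Let A j := Wb *m L j *m coord_in (V *m L j).
Let D j := Wb *m L j *m coord_out (V *m L j).

Let VbL j : (Vb *m L j :=: V *m L j)%MS.
Proof. exact: eqmxMr (eq_row_base V). Qed.

Let VbL0 : V *m L0 = 0%R -> Vb *m L0 = 0%R.
Proof.
move=> VL0; have /submxP[Q ->] : (Vb <= V)%MS by rewrite eq_row_base.
by rewrite -mulmxA VL0 mulmx0.
Qed.

Let PVj j : Vb *m L j = P j *m Vj j.
Proof.
have : (Vb *m L j <= Vj j)%MS by rewrite eq_row_base VbL.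
move=> /submxP[Q E]; rewrite /P E.
by case: (split_mxP (V *m L j)) => VG _ _ _ _; rewrite -(mulmxA Q) VG mulmx1.
Qed.

Let rankP v (U : 'M[R]_(v, \rank V)) j : \rank (U *m P j) = \rank (U *m Vb *m L j).
Proof.
rewrite -[in RHS]mulmxA [X in _ = \rank (_ *m X)]PVj [in RHS]mulmxA.
by rewrite [RHS](mxrankMfree _ (split_row_freel (split_mxP (V *m L j)))).
Qed.

Let rankVb v (U : 'M[R]_(v, \rank V)) : \rank (U *m Vb) = \rank U.
Proof. by rewrite (mxrankMfree _ (split_row_freel (split_mxP V))). Qed.

Let rankX v (U : 'M[R]_(v, \rank V^C)) :
  \rank (col_mx Vb (U *m Wb)) = (\rank V + \rank U)%N.
Proof.
rewrite (rank_split (split_mxP V))//.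
by case: (split_mxP V) => _ _ _ WK _; rewrite -mulmxA WK mulmx1.
Qed.

Let rankXL v (U : 'M[R]_(v, \rank V^C)) j :
  \rank (col_mx Vb (U *m Wb) *m L j) = (\rank (V *m L j) + \rank (U *m D j))%N.
Proof.
rewrite mul_col_mx (rank_split (split_mxP (V *m L j))); last first.
  exact: eqmx_trans (VbL j) (eqmx_sym (eq_row_base _)).
by rewrite /D !mulmxA.
Qed.

Let compl_rank j : ((\rank (V *m L j)^C%MS)%:R = (nj j)%:R - (\rank (V *m L j))%:R :> R)%R.
Proof. by rewrite mxrank_compl natrB// rank_leq_col. Qed.

(** The condition on kernels is inherited by subspaces of V. The codimension condition inside V
    follows by subtraction from the equality for V: if V is critical for the first family it lies in
    the kernel of [L0], so the first condition applies to every subspace of it; otherwise the second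
    one is used. *)
Let feasible_inner : tight_ker L0 L s V \/ tight_codim L s V ->
  feasible (Vb *m L0) P s.
Proof.
case: feas => s01 f1 f2 tight; split => // v U.
  rewrite mulmxA => /f1; rewrite rankVb => /le_trans; apply.
  by apply: ler_sum => j _; rewrite rankP.
case: tight => [[VL0 VE]|VE].
  have := f1 _ (U *m Vb); rewrite rankVb.
  have -> : U *m Vb *m L0 = 0%R.
    by rewrite -mulmxA VbL0 ?mulmx0.
  move=> /(_ erefl); under eq_bigr do rewrite -rankP.
  by rewrite sumsB VE => ?; lra.
have := f2 _ (U *m Vb); rewrite rankVb.
under eq_bigr do rewrite -rankP.
by move: VE; rewrite /tight_codim !sumsB => ? ?; lra.
Qed.

(** A subspace U of the quotient is tested through its preimage, spanned by V and U, whose rank and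
    image ranks are sums. When V is critical for codimensions, subtracting the equality from the
    codimension condition gives dim U <= sum_j s_j dim(D_j U) for every U, whence any [M0] is
    allowed. *)
Let feasible_outer (M0 : 'M[R]_(\rank V^C, k)) :
  (tight_ker L0 L s V /\ M0 = Wb *m L0) \/ tight_codim L s V ->
  feasible M0 D s.
Proof.
case: feas => s01 f1 f2 tight; split => // v U.
  move=> UM0; case: tight => [[[VL0 VE] M0E]|VE].
    have := f1 _ (col_mx Vb (U *m Wb)); rewrite rankX.
    have -> : col_mx Vb (U *m Wb) *m L0 = 0%R.
      by rewrite mul_col_mx -(mulmxA U) -M0E UM0 VbL0// col_mx0.
    move=> /(_ erefl); under eq_bigr do rewrite rankXL natrD mulrDr.
    by rewrite big_split/= natrD VE => ?; lra.
  have := f2 _ (col_mx Vb (U *m Wb)); rewrite rankX.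
  under eq_bigr do rewrite rankXL natrD opprD addrA mulrBr.
  by move: VE; rewrite /tight_codim sumrB natrD => -> ?; lra.
have := f2 _ (col_mx Vb (U *m Wb)); rewrite rankX.
under eq_bigr do rewrite rankXL natrD opprD addrA.
under [X in _ -> (X <= _)%R]eq_bigr do rewrite compl_rank.
have WE : ((\rank V^C%MS)%:R = n%:R - (\rank V)%:R :> R)%R.
  by rewrite mxrank_compl natrB// rank_leq_col.
by rewrite natrD => ?; lra.
Qed.

Lemma bl_bound_tight : tight_ker L0 L s V \/ tight_codim L s V ->
  (0 < \rank V < n)%N ->
  (forall n' k' (nj' : 'I_m -> nat) (L0' : 'M[R]_(n', k'))
    (L' : forall j, 'M[R]_(n', nj' j)) (s' : 'I_m -> R), (n' < n)%N ->
    feasible L0' L' s' -> bl_bound L0' L' s') ->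
  bl_bound L0 L s.
Proof.
move=> tight /andP[V0 Vn] IH.
have WLE j : Wb *m L j = (A j *m Vj j + D j *m Wj j)%R.
  by rewrite /A /D /Vj /Wj; exact: (split_decomp (split_mxP (V *m L j)) (Wb *m L j)).
have s0 j : (0 <= s j)%R by case: feas => /(_ j)/andP[].
have WCn : (\rank V^C%MS < n)%N by rewrite mxrank_compl; lia.
have inner := IH _ _ _ _ _ _ Vn (feasible_inner tight).
case: tight => tight.
- apply: (bl_bound_factor (split_mxP V) (fun j => split_mxP (V *m L j)) s0 PVj WLE
    (M0 := Wb *m L0) _ inner).
    move=> c; exists c => x y; rewrite /cut/= /affine2 tuple_of_rowK addr0 mulmxDl.
    rewrite -(mulmxA (row_of x)) -(mulmxA (row_of y)).
    by rewrite VbL0 ?mulmx0 ?add0r//; case: tight.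
  by apply: IH => //; apply: feasible_outer; left.
(* The outer problem carries no cut-off here: [cut 0 0] is the whole space. *)
- apply: (bl_bound_factor (split_mxP V) (fun j => split_mxP (V *m L j)) s0 PVj WLE
    (M0 := 0%R) _ inner).
    move=> c; exists 0%R => x y _; rewrite /cut/= mulmx0 addr0 => i.
    by rewrite tnth_mktuple mxE normr0.
  by apply: IH => //; apply: feasible_outer; right.
Qed.

End TightStep.

(** * Extreme and non-extreme exponents *)

Lemma integral_tuple0 (f : T 0 -> \bar R) x : (forall y, 0 <= f y) ->
  measurable_fun setT f -> \int[lam 0]_y f y = f x.
Proof.
move=> f0 mf; rewrite integral_dirac// diracT mul1e.
by rewrite (tuple0 x).
Qed.

(** The case of [ge0_integral_split] in which the inner integral runs over a zero-dimensional
    space. *)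
Lemma ge0_integral_linear_iso b n (W : 'M[R]_(b, n)) : row_free W -> row_full W ->
  exists2 c : R, (0 < c)%R & forall f : T n -> \bar R,
    measurable_fun setT f -> (forall x, 0 <= f x) ->
    \int[lam b]_y f (linear_map W y) = c%:E * \int[lam n]_z f z.
Proof.
move=> rW fW.
have sp : split_basis (0 : 'M[R]_(0, n))%R W (0 : 'M[R]_(n, 0))%R (pinvmx W).
  split; rewrite ?mul0mx ?mulmx0 ?add0r ?mulmxVp ?mulVpmx//.
  by apply/matrixP => -[].
have [c c0 H] := ge0_integral_split sp.
exists c^-1%R; first by rewrite invr_gt0.
move=> f mf f0; rewrite H// muleA -EFinM mulVf ?gt_eqF// mul1e.
apply: eq_integral => y _; rewrite (integral_tuple0 [tuple])//.
  by rewrite /affine2 mulmx0 add0r addr0.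
apply: (measurableT_comp mf); exact: measurable_affine2.
Qed.

Section Feasible.
Variables (n k m : nat) (nj : 'I_m -> nat) (L0 : 'M[R]_(n, k)).
Variables (L : forall j, 'M[R]_(n, nj j)).
Implicit Types s d : 'I_m -> R.

(** For the whole space the codimension condition reads sum_j s_j (n_j - rank L_j) <= 0, a sum of
    nonnegative terms. *)
Lemma feasible_rank s j : feasible L0 L s -> (0 < s j)%R -> \rank (L j) = nj j.
Proof.
case=> s01 _ f2 sj; apply/eqP; rewrite eqn_leq rank_leq_col/=.
have := f2 _ (1%:M : 'M[R]_n); rewrite mxrank1 subrr => h.
have t0 i : (0 <= s i * ((nj i)%:R - (\rank (1%:M *m L i))%:R))%R.
  by rewrite mulr_ge0 ?subr_ge0 ?ler_nat ?rank_leq_col//; case/andP: (s01 i).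
have : (s j * ((nj j)%:R - (\rank (1%:M *m L j))%:R) <= 0)%R.
  by apply: le_trans h; rewrite (bigD1 j)//= lerDl sumr_ge0.
by rewrite pmulr_rle0// subr_le0 ler_nat mul1mx.
Qed.

Lemma capker (J : pred 'I_m) (r : seq 'I_m) :
  exists V : 'M[R]_n, (forall j, j \in r -> J j -> V *m L j = 0%R) /\
    (n <= \rank V + \sum_(j <- r | J j) \rank (L j))%N.
Proof.
elim: r => [|i r [V [VL nV]]].
  by exists 1%:M; split => //; rewrite mxrank1 leq_addr.
rewrite big_cons; case: ifPn => Ji; last first.
  exists V; split => // j; rewrite inE => /predU1P[->|/VL//].
  by rewrite (negbTE Ji).
exists (V :&: kermx (L i))%MS; split => [j|].
  rewrite inE => /predU1P[->|jr] Jj.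
    by apply/sub_kermxP; exact: capmxSr.
  have /submxP[Q ->] := capmxSl V (kermx (L i)).
  by rewrite -mulmxA (VL _ jr Jj) mulmx0.
have := mxrank_sum_cap V (kermx (L i)); rewrite mxrank_ker.
have := rank_leq_row (L i); have := rank_leq_col (V + kermx (L i))%MS.
move: nV; set S := (\sum_(_ <- _ | _) _)%N; lia.
Qed.

(* For [V] the common kernel of the maps with exponent 1, all the inequalities in
   [codim V >= sum_j s_j codim (L_j V) >= sum_(s_j = 1) n_j >= codim V] are equalities. *)
Lemma capker_tight s : feasible L0 L s ->
  exists V : 'M[R]_n, [/\ tight_codim L s V,
    forall j, (0 < s j < 1)%R -> \rank (V *m L j) = nj j &
    (n%:R - (\rank V)%:R = \sum_(j | s j == 1%R) (nj j)%:R :> R)%R].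
Proof.
move=> feas; have [s01 _ f2] := feas.
have [V [VL nV]] := capker (fun j => s j == 1%R) (index_enum _).
exists V.
have t0 i : (0 <= s i * ((nj i)%:R - (\rank (V *m L i))%:R))%R.
  by rewrite mulr_ge0 ?subr_ge0 ?ler_nat ?rank_leq_col//; case/andP: (s01 i).
have h2 := f2 _ V.
have sumE : (\sum_j s j * ((nj j)%:R - (\rank (V *m L j))%:R) =
    \sum_(j | s j == 1) (nj j)%:R +
    \sum_(j | s j != 1) s j * ((nj j)%:R - (\rank (V *m L j))%:R))%R.
  rewrite (bigID (fun j => s j == 1%R))/=; congr (_ + _)%R.
  apply: eq_bigr => j /[dup] Jj /eqP ->.
  by rewrite VL ?mem_index_enum// mxrank0 subr0 mul1r.
have rest0 : (0 <= \sum_(j | s j != 1) s j * ((nj j)%:R - (\rank (V *m L j))%:R))%R.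
  by apply: sumr_ge0.
have up : (n%:R - (\rank V)%:R <= \sum_(j | s j == 1) (nj j)%:R :> R)%R.
  rewrite lerBlDl -natr_sum -natrD ler_nat (leq_trans nV)// leq_add2l.
  by apply: leq_sum => j _; exact: rank_leq_col.
have restE : (\sum_(j | s j != 1) s j * ((nj j)%:R - (\rank (V *m L j))%:R) = 0)%R.
  by rewrite sumE in h2; lra.
split.
- by rewrite /tight_codim sumE; rewrite sumE in h2; lra.
- move=> j /andP[sj0 sj1].
  have : (s j * ((nj j)%:R - (\rank (V *m L j))%:R) = 0)%R.
    have j1 : s j != 1%R by rewrite lt_eqF.
    by apply: (psumr_eq0P _ restE) => // i _.
  by move/eqP; rewrite mulf_eq0 gt_eqF//= subr_eq0 eqr_nat => /eqP.
- by rewrite sumE in h2; lra.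
Qed.

Definition nontrivial_tight s : Prop := exists u (V : 'M[R]_(u, n)),
  (tight_ker L0 L s V \/ tight_codim L s V) /\ (0 < \rank V < n)%N.

Lemma nontrivialN s u (V : 'M[R]_(u, n)) : ~ nontrivial_tight s ->
  tight_ker L0 L s V \/ tight_codim L s V -> \rank V = 0%N \/ \rank V = n.
Proof.
move=> nt tight; have := rank_leq_col V; rewrite leq_eqVlt => /predU1P[->|Vn]; first by right.
left; apply/eqP; rewrite -leqn0 leqNgt; apply/negP => V0.
by apply: nt; exists u, V; rewrite V0.
Qed.

(** If the common kernel is everything, the maps with exponent 1 go to zero-dimensional spaces, so
    the integrand is constant; the kernel condition makes [L0] injective, and the cut-off has finite
    volume. If the common kernel is 0 and n > 0, each n_j with s_j = 1 is 0 or n while their sum is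
    n, so exactly one of these maps is an isomorphism and the others contribute constants. *)
Lemma bl_bound_extreme s : feasible L0 L s -> (forall j, s j = 0%R \/ s j = 1%R) ->
  ~ nontrivial_tight s -> bl_bound L0 L s.
Proof.
move=> feas s01 nt.
have const (j : 'I_m) (f : T (nj j) -> \bar R) x : s j = 1%R -> nj j = 0%N ->
    measurable_fun setT f -> (forall y, 0 <= f y) ->
    f x = \int[lam (nj j)]_y f y.
  by move=> _ nj0; move: f x; rewrite nj0 => f x mf f0; rewrite (integral_tuple0 x).
have [V [Vt _ VE]] := capker_tight feas.
have [Vn|[V0 n0]] : \rank V = n \/ \rank V = 0%N /\ (0 < n)%N.
  have [V0|Vn] := nontrivialN nt (or_intror Vt); last by left.
  by have [n0|n0] := posnP n; [left; rewrite V0 n0|right].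
  have nj0 j : s j = 1%R -> nj j = 0%N.
    move=> sj; move: VE; rewrite Vn subrr => /esym/psumr_eq0P => /(_ (fun _ _ => ler0n _ _)).
    by move=> /(_ j); rewrite sj eqxx => /(_ erefl)/eqP; rewrite pnatr_eq0 => /eqP.
  have /row_freeP[K L0K] : row_free L0.
    rewrite -kermx_eq0 -mxrank_eq0 -leqn0 -(ler_nat R).
    case: feas => _ f1 _; apply: le_trans (f1 _ (kermx L0) (mulmx_ker _)) _.
    rewrite big1// => j _; case: (s01 j) => [->|sj]; first by rewrite mul0r.
    have := rank_leq_col (kermx L0 *m L j); rewrite [X in (_ <= X)%N](nj0 j sj) leqn0 => /eqP ->.
    by rewrite mulr0.
  have [C C0 HC] := cut_volume L0K; exists C => // c f mf f0.
  have M0 : 0 <= \prod_j (\int[lam (nj j)]_x f j x) `^ s j.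
    by apply: eprod_ge0 => j _; exact: poweR_ge0.
  under eq_integral => x _.
    under eq_bigr => j _.
      rewrite (_ : _ `^ s j = (\int[lam (nj j)]_y f j y) `^ s j); last first.
        case: (s01 j) => [->|sj]; first by rewrite !poweRe0.
        by rewrite (const j (f j))// nj0.
      over.
    over.
  rewrite integral_cst; last exact: measurable_cut.
  by rewrite muleC; apply: lee_wpmul2r => //; exact: HC.
(* The kernel of each map with exponent 1 is critical as well. *)
have nj0n j : s j = 1%R -> nj j = 0%N \/ nj j = n.
  move=> sj; have rj : \rank (L j) = nj j by apply: (feasible_rank feas); rewrite sj.
  have rU := mxrank_ker (L j); rewrite rj in rU.
  have njn : (nj j <= n)%N by rewrite -rj rank_leq_row.
  have tU : tight_codim L s (kermx (L j)).
    case: (feas) => s01' _ f2; apply/eqP; rewrite eq_le f2/= rU natrB// opprB addrC subrK.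
    rewrite (bigD1 j)//= mulmx_ker mxrank0 subr0 sj mul1r lerDl sumr_ge0// => i _.
    by rewrite mulr_ge0 ?subr_ge0 ?ler_nat ?rank_leq_col//; case/andP: (s01' i).
  by have := nontrivialN nt (or_intror tU); rewrite rU; lia.
have [j0 sj0 nj0] : exists2 j, s j = 1%R & nj j = n.
  apply: contrapT => H; move: VE; rewrite V0 subr0 big1 => [/eqP|j /eqP sj].
    by rewrite pnatr_eq0 gtn_eqF.
  by have [->//|njn] := nj0n j sj; exfalso; apply: H; exists j.
have others i : i != j0 -> s i = 1%R -> nj i = 0%N.
  move=> ij0 si; move: VE; rewrite V0 subr0 (bigD1 j0) ?sj0 ?eqxx//= nj0.
  rewrite (bigD1 i) ?si ?eqxx//= => E.
  have : (0 <= \sum_(j | ((s j == 1) && (j != j0)) && (j != i)) (nj j)%:R :> R)%R by exact: sumr_ge0.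
  have : (0 <= (nj i)%:R :> R)%R by [].
  move=> ? ?; have /eqP : (nj i)%:R = 0%R :> R by lra.
  by rewrite pnatr_eq0 => /eqP.
have rj : \rank (L j0) = nj j0 by apply: (feasible_rank feas); rewrite sj0.
have [c c0 Hc] : exists2 c : R, (0 < c)%R & forall f : T (nj j0) -> \bar R,
    measurable_fun setT f -> (forall x, 0 <= f x) ->
    \int[lam n]_y f (linear_map (L j0) y) = c%:E * \int[lam (nj j0)]_z f z.
  apply: ge0_integral_linear_iso; apply/eqP; rewrite rj//.
exists c => [|c' f mf f0]; first exact: ltW.
have M0 : 0 <= \prod_(j | j != j0) (\int[lam (nj j)]_x f j x) `^ s j.
  by apply: eprod_ge0 => j _; exact: poweR_ge0.
have mfL : measurable_fun setT (fun x => f j0 (linear_map (L j0) x)).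
  exact: (measurableT_comp (mf j0) (measurable_linear_map _)).
have E x : \prod_j f j (linear_map (L j) x) `^ s j = f j0 (linear_map (L j0) x) *
    \prod_(j | j != j0) (\int[lam (nj j)]_x f j x) `^ s j.
  rewrite (bigD1 j0)//= sj0 poweRe1//; congr (_ * _); apply: eq_bigr => j jj0.
  case: (s01 j) => [->|sj]; first by rewrite !poweRe0.
  by rewrite (const j (f j))// others.
under eq_integral do rewrite E.
rewrite ge0_integralZr//; last 2 first.
- exact: measurable_cut.
- exact: measurable_funTS.
rewrite [X in _ <= _ * X](bigD1 j0)//= sj0 poweRe1; last exact: integral_ge0.
rewrite muleA; apply: lee_wpmul2r => //; rewrite -Hc//.
by apply: ge0_subset_integral => //; exact: measurable_cut.
Qed.

(** The ratio test of linear programming: [t] minimizes [al i / - be i] over the constraints that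
    decrease. *)
Lemma first_zero (I : finType) (Pr : pred I) (al be : I -> R) :
  (forall i, Pr i -> (0 <= al i)%R) -> (exists2 i, Pr i & (be i < 0)%R) ->
  exists t : R, [/\ (0 <= t)%R, forall i, Pr i -> (0 <= al i + t * be i)%R &
    exists i, [/\ Pr i, (be i < 0)%R & (al i + t * be i = 0)%R]].
Proof.
move=> al0 [i0 Pi0 bi0].
pose Q i := Pr i && (be i < 0)%R.
have Qi0 : Q i0 by rewrite /Q Pi0.
case: (Order.TotalTheory.arg_minP (fun i => (al i / - be i)%R) Qi0) => i /andP[Pi bi] imin.
exists (al i / - be i)%R; split.
- by rewrite divr_ge0 ?al0// oppr_ge0 ltW.
- move=> j Pj; have [bj|bj] := ltP (be j) 0%R; last first.
    by rewrite addr_ge0 ?al0// mulr_ge0// divr_ge0 ?al0// oppr_ge0 ltW.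
  have := imin j; rewrite /Q Pj bj => /(_ isT).
  rewrite ler_pdivlMr ?oppr_gt0// => h; lra.
- by exists i; split => //; field; rewrite lt_eqF.
Qed.

(** Follow the ray from [s] in direction [d] until a constraint that decreases along it becomes an
    equality. The alternatives list its possible origin: a bound 0 or 1 on an exponent, a proper
    nonzero subspace, or one of the subspaces 0 and H, where the equality is sum_j s'_j n_j = n and
    [d] changes this sum. *)
Lemma feasible_move s d : feasible L0 L s ->
  (forall j, d j != 0%R -> (0 < s j < 1)%R) -> (exists j, d j != 0%R) ->
  exists t : R, let s' := (fun j => s j + t * d j)%R in
  [/\ (0 <= t)%R, feasible L0 L s' &
    [\/ exists2 j, d j != 0%R & s' j = 0%R \/ s' j = 1%R,
        nontrivial_tight s' |
        (\sum_j d j * (nj j)%:R != 0)%R /\ (\sum_j s' j * (nj j)%:R = n%:R)%R]].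
Proof.
move=> feas dfrac [j0 dj0]; have [s01 f1 f2] := feas.
(* A constraint depends on the subspace only through the ranks recorded in [rk], so there are
   finitely many; [lin 1 s] is the affine form of a constraint and [lin 0] its linear part. *)
pose rk := ('I_n.+1 * {ffun 'I_m -> 'I_n.+1})%type.
pose realized (z : bool) (r : rk) := exists u (V : 'M[R]_(u, n)),
  [/\ z -> V *m L0 = 0%R, r.1 = \rank V :> nat & forall j, r.2 j = \rank (V *m L j) :> nat].
pose Pr (i : ('I_m * bool) + (bool * rk)) : bool :=
  match i with inl _ => true | inr (z, r) => `[< realized z r >] end.
pose lin (e : R) (x : 'I_m -> R) (i : ('I_m * bool) + (bool * rk)) : R :=
  match i with
  | inl (j, true) => x j
  | inl (j, false) => (e - x j)%R
  | inr (true, r) => (\sum_j x j * (r.2 j : nat)%:R - e * (r.1 : nat)%:R)%R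
  | inr (false, r) => (e * (n%:R - (r.1 : nat)%:R) - \sum_j x j * ((nj j)%:R - (r.2 j : nat)%:R))%R
  end.
have linD t i : (lin 1 s i + t * lin 0 d i = lin 1 (fun j => s j + t * d j) i)%R.
  case: i => [[j []]|[[] r]] /=; first by [].
  - by ring.
  - rewrite mul0r subr0 mul1r mulr_sumr addrAC -big_split/=; congr (_ - _)%R.
    by apply: eq_bigr => j _; ring.
  - rewrite mul0r sub0r mul1r mulrN mulr_sumr -addrA -opprD -big_split/=; congr (_ - _)%R.
    by apply: eq_bigr => j _; ring.
have pos0 i : Pr i -> (0 <= lin 1 s i)%R.
  case: i => [[j b]|[z r]] /=.
    by move=> _; have /andP[? ?] := s01 j; case: b; rewrite ?subr_ge0.
  move=> /asboolP[u [V [VL0 r1 r2]]]; case: z VL0 => VL0; rewrite mul1r subr_ge0 r1;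
    under eq_bigr do rewrite r2; [exact/f1/VL0|exact: f2].
(* Since [d j0] is nonzero, the ray approaches one of the bounds 0 and 1 for this exponent, so it
   cannot go on for ever. *)
have neg : exists2 i, Pr i & (lin 0 d i < 0)%R.
  have [dj|dj] := ltP (d j0) 0%R; first by exists (inl (j0, true)).
  by exists (inl (j0, false)) => //=; rewrite sub0r oppr_lt0 lt_neqAle eq_sym dj0.
have [t [t0 post [i [Pi bi ti]]]] := first_zero pos0 neg.
exists t => s'; rewrite linD -/s' in ti.
have {}post i' : Pr i' -> (0 <= lin 1 s' i')%R by move=> /post; rewrite linD.
pose rkV u (V : 'M[R]_(u, n)) : rk := (inord (\rank V), [ffun j => inord (\rank (V *m L j))]).
have real (z : bool) u (V : 'M[R]_(u, n)) : (z -> V *m L0 = 0%R) ->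
    Pr (inr (z, rkV u V)).
  move=> VL0; apply/asboolP; exists u, V; split => //=.
    by rewrite inordK// ltnS rank_leq_col.
  move=> j; rewrite ffunE inordK// ltnS.
  exact: leq_trans (mxrankM_maxl _ _) (rank_leq_col _).
have linE (x : 'I_m -> R) e (z : bool) u (V : 'M[R]_(u, n)) :
    lin e x (inr (z, rkV u V)) =
    if z then (\sum_j x j * (\rank (V *m L j))%:R - e * (\rank V)%:R)%R
    else (e * (n%:R - (\rank V)%:R) - \sum_j x j * ((nj j)%:R - (\rank (V *m L j))%:R))%R.
  have E1 : @inord n (\rank V) = \rank V :> nat by rewrite inordK// ltnS rank_leq_col.
  have E2 j : @inord n (\rank (V *m L j)) = \rank (V *m L j) :> nat.
    rewrite inordK// ltnS; exact: leq_trans (mxrankM_maxl _ _) (rank_leq_col _).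
  by case: z => /=; rewrite E1; under eq_bigr do rewrite ffunE E2.
have feas' : feasible L0 L s'.
  split.
  - move=> j; have := post (inl (j, true)) isT; have := post (inl (j, false)) isT => /=.
    by rewrite subr_ge0 => -> ->.
  - move=> u V VL0; have := post _ (real true u V (fun=> VL0)).
    by rewrite linE mul1r subr_ge0.
  - move=> u V; have := post _ (real false u V (fun H => False_ind _ (notF H))).
    by rewrite linE mul1r subr_ge0.
split => //.
have dfull j : d j != 0%R -> \rank (L j) = nj j.
  by move=> /dfrac/andP[sj _]; exact: feasible_rank feas sj.
have s'full j : s' j != 0%R -> \rank (L j) = nj j.
  move=> sj; apply: (feasible_rank feas'); rewrite lt0r sj.
  by case: feas' => /(_ j)/andP[].
case: i Pi bi ti => [[j [|]]|[z r]] Pi.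
- by move=> /= bi ti; apply: Or31; exists j; [rewrite lt_eqF|left].
- move=> /= bi ti; apply: Or31; exists j; last by right; lra.
  by apply/eqP => dj; move: bi; rewrite dj subrr ltxx.
move: Pi => /asboolP[u [V [VL0 r1 r2]]] bi ti.
have {}bi : (if z then \sum_j d j * (\rank (V *m L j))%:R < 0
    else 0 < \sum_j d j * ((nj j)%:R - (\rank (V *m L j))%:R))%R.
  move: bi; case: z {VL0 ti} => /=; under eq_bigr do rewrite r2; rewrite mul0r.
    by rewrite subr0.
  by rewrite sub0r oppr_lt0.
have {}ti : if z then (\rank V)%:R = (\sum_j s' j * (\rank (V *m L j))%:R)%R
    else tight_codim L s' V.
  move: ti; rewrite /tight_codim; case: z {VL0 bi} => /=; under eq_bigr do rewrite r2;
    rewrite mul1r r1 => /subr0_eq ->//.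
have rn j : \rank V = n -> \rank (V *m L j) = \rank (L j).
  by move=> /eqP rf; rewrite (eqmxMfull _ rf).
have tight' : tight_ker L0 L s' V \/ tight_codim L s' V.
  by case: z VL0 ti {bi} => VL0 ti; [left; split => //; exact: VL0|right].
have [Vnt|] := boolP (0 < \rank V < n)%N; first by apply: Or32; exists u, V.
(* For V = 0 only the codimension constraint varies along [d], for V = H only the kernel constraint,
   because [L j] is onto wherever [d j] or [s' j] is nonzero. Either equality is sum_j s'_j n_j =
   n. *)
rewrite negb_and -leqNgt -leqNgt leqn0 => Vtriv; apply: Or33.
have r0 j : \rank V = 0%N -> \rank (V *m L j) = 0%N.
  by move=> V0; apply/eqP; rewrite -leqn0 -V0 mxrankM_maxl.
have [V0|V0] := eqVneq (\rank V) 0%N.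
  have {}r0 j := r0 j V0.
  case: z {VL0 tight'} bi ti => bi ti.
    by move: bi; rewrite big1 ?ltxx// => j _; rewrite r0 mulr0.
  move: bi ti; rewrite /tight_codim V0; under eq_bigr do rewrite r0 subr0.
  move=> bi; under eq_bigr do rewrite r0 subr0; rewrite subr0 => ->.
  by split => //; rewrite gt_eqF.
have {}Vtriv : \rank V = n.
  by move: Vtriv; rewrite (negbTE V0)/= => nV; apply/eqP; rewrite eqn_leq rank_leq_col.
have E x : (forall j, x j != 0%R -> \rank (L j) = nj j) ->
    (\sum_j x j * (\rank (V *m L j))%:R = \sum_j x j * (nj j)%:R :> R)%R.
  move=> xf; apply: eq_bigr => j _; have [->|xj] := eqVneq (x j) 0%R; first by rewrite !mul0r.
  by rewrite rn// xf.
case: z {VL0 tight'} bi ti => bi ti.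
  by move: bi ti; rewrite !E// Vtriv => bi <-; split => //; rewrite lt_eqF.
move: bi; rewrite big1 ?ltxx// => j _.
have [->|dj] := eqVneq (d j) 0%R; first by rewrite mul0r.
by rewrite rn// dfull// subrr mulr0.
Qed.

End Feasible.

(** The common kernel V of the maps with exponent 1 is critical, and [L j0] maps it onto a nonzero
    space, so V is nonzero. If V were everything, n_j would vanish whenever s_j = 1, and the sum
    would reduce to s_j0 n_j0 = n >= n_j0, against s_j0 < 1. *)
Lemma single_fractional_tight n k m (nj : 'I_m -> nat) (L0 : 'M[R]_(n, k))
    (L : forall j, 'M[R]_(n, nj j)) (s : 'I_m -> R) j0 :
  feasible L0 L s -> (0 < s j0 < 1)%R -> (0 < nj j0)%N ->
  (forall j, j != j0 -> s j = 0%R \/ s j = 1%R) ->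
  (\sum_j s j * (nj j)%:R = n%:R)%R -> nontrivial_tight L0 L s.
Proof.
move=> feas sj0 nj0 s01 sE; have [V [Vt Vr VE]] := capker_tight feas.
have rV := Vr _ sj0.
have njV : (nj j0 <= \rank V)%N by rewrite -rV mxrankM_maxl.
exists n, V; split; first by right.
rewrite (leq_trans nj0)//= ltn_neqAle rank_leq_col andbT.
apply/eqP => Vn; move: VE; rewrite Vn subrr => /esym/psumr_eq0P => /(_ (fun _ _ => ler0n _ _)) n0.
have nj0n : (nj j0 <= n)%N by rewrite -Vn.
move: sE; rewrite (bigD1 j0)//= big1 => [|j jj0]; last first.
  case: (s01 _ jj0) => sj; first by rewrite sj mul0r.
  by rewrite (n0 j) ?sj ?mulr0.
rewrite addr0 => sE; case/andP: sj0 => _ sj1.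
have : (s j0 * (nj j0)%:R < (nj j0)%:R)%R by rewrite gtr_pMl// ltr0n.
by rewrite sE ltr_nat ltnNge nj0n.
Qed.

Definition fractional m (s : 'I_m -> R) := [set j : 'I_m | (0 < s j < 1)%R]%SET.

(** Both rays from [s], along [d] and [- d], end at exponents already covered: either an exponent
    has reached 0 or 1, which leaves fewer strictly between, or there is a nontrivial critical
    subspace. The last hypothesis provides the latter when the ray is stopped by 0 or H. *)
Lemma bl_bound_perturb n k m (nj : 'I_m -> nat) (L0 : 'M[R]_(n, k))
    (L : forall j, 'M[R]_(n, nj j)) (s d : 'I_m -> R) :
  (forall s', feasible L0 L s' -> (#|fractional s'| < #|fractional s|)%N -> bl_bound L0 L s') ->
  (forall s', feasible L0 L s' -> nontrivial_tight L0 L s' -> bl_bound L0 L s') ->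
  feasible L0 L s ->
  (forall j, d j != 0%R -> (0 < s j < 1)%R) -> (exists j, d j != 0%R) ->
  (forall s', feasible L0 L s' -> (forall j, d j = 0%R -> s' j = s j) ->
    (\sum_j d j * (nj j)%:R != 0)%R -> (\sum_j s' j * (nj j)%:R = n%:R)%R ->
    (forall j, d j != 0%R -> (0 < s' j < 1)%R) -> nontrivial_tight L0 L s') ->
  bl_bound L0 L s.
Proof.
move=> IHf IHt feas dfrac dn0 Hscal.
have shrink s' : (forall j, d j = 0%R -> s' j = s j) ->
    (exists2 j, d j != 0%R & s' j = 0%R \/ s' j = 1%R) ->
    (#|fractional s'| < #|fractional s|)%N.
  move=> s's [j dj s'j]; apply: proper_card; apply/properP; split.
    apply/fintype.subsetP => i; rewrite !inE; have [di|di] := eqVneq (d i) 0%R.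
      by rewrite s's.
    by move=> _; exact: dfrac.
  exists j; rewrite !inE ?dfrac//.
  by case: s'j => ->; rewrite ltxx ?andbF.
have go (d' : 'I_m -> R) : (forall j, (d' j == 0%R) = (d j == 0%R)) ->
    ((\sum_j d' j * (nj j)%:R == 0) = (\sum_j d j * (nj j)%:R == 0))%R ->
    exists t : R, [/\ (0 <= t)%R, forall j, (0 <= s j + t * d' j)%R &
      bl_bound L0 L (fun j => s j + t * d' j)%R].
  move=> d'0 d'sum.
  have [||t [t0 feas' alt]] := @feasible_move n k m nj L0 L s d' feas.
  - by move=> j; rewrite d'0; exact: dfrac.
  - by have [j dj] := dn0; exists j; rewrite d'0.
  exists t; set s' := (fun j => _) in feas' alt *.
  split => // [j|]; first by case: feas' => /(_ j)/andP[].
  have s's j : d j = 0%R -> s' j = s j.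
    by move=> dj; rewrite /s'; have := d'0 j; rewrite dj eqxx => /eqP ->; rewrite mulr0 addr0.
  case: alt => [[j dj s'j]||[dsum s'sum]].
  - by apply: IHf => //; apply: shrink => //; exists j; rewrite -?d'0.
  - exact: IHt.
  - have [[j dj s'j]|H] := pselect (exists2 j, d j != 0%R & s' j = 0%R \/ s' j = 1%R).
      by apply: IHf => //; apply: shrink => //; exists j.
    apply: IHt => //; apply: Hscal => //; first by rewrite -d'sum.
    move=> j dj; have /andP[s'0 s'1] : (0 <= s' j <= 1)%R by case: feas' => /(_ j).
    rewrite !lt_neqAle s'0 s'1 !andbT; apply/andP; split; apply/eqP => E; apply: H.
      by exists j => //; left.
    by exists j => //; right.
have [t [t0 st0 Ht]] := go d (fun=> erefl) erefl.
have [t' [t'0 st'0 Ht']] : exists t : R, [/\ (0 <= t)%R, forall j, (0 <= s j + t * - d j)%R &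
      bl_bound L0 L (fun j => s j + t * - d j)%R].
  apply: (go (fun j => - d j)%R) => [j|]; first by rewrite oppr_eq0.
  by under eq_bigr do rewrite mulNr; rewrite sumrN oppr_eq0.
(* If neither ray moves, the bound at its endpoint is already the bound at [s]. *)
have [tt|tt] := eqVneq (t + t')%R 0%R.
  have t_0 : t = 0%R by lra.
  by move: Ht; rewrite t_0; congr bl_bound; apply/funext => j; rewrite mul0r addr0.
have tt0 : (0 < t + t')%R by rewrite lt0r tt addr_ge0.
suff -> : s = (fun j => (t' / (t + t')) * (s j + t * d j) +
    (1 - t' / (t + t')) * (s j + t' * - d j))%R.
  apply: bl_bound_interpolate => //; first by rewrite divr_ge0// ltW.
  by rewrite ler_pdivrMr// mul1r lerDr.
by apply/funext => j; field.
Qed.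

(** Each direction of motion is picked so that equality for 0 or H does no harm: it leaves sum_j s_j
    n_j unchanged, or, with a single exponent strictly between 0 and 1, that equality yields a
    critical subspace. *)
Lemma feasible_bl_bound n k m (nj : 'I_m -> nat) (L0 : 'M[R]_(n, k))
    (L : forall j, 'M[R]_(n, nj j)) (s : 'I_m -> R) :
  feasible L0 L s -> bl_bound L0 L s.
Proof.
elim/ltn_ind: n k nj L0 L s => n IHn k nj L0 L s.
have [q] := ubnP #|fractional s|; elim: q s => // q IHq s sq feas.
have IHt s' : feasible L0 L s' -> nontrivial_tight L0 L s' -> bl_bound L0 L s'.
  move=> feas' [u [V [tight Vn]]]; apply: bl_bound_tight feas' _ _ tight Vn _.
  by move=> *; exact: IHn.
have [nt|nt] := pselect (nontrivial_tight L0 L s); first exact: IHt.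
have IHf s' : feasible L0 L s' -> (#|fractional s'| < #|fractional s|)%N -> bl_bound L0 L s'.
  by move=> feas' lt; apply: IHq => //; exact: leq_trans lt _.
have [[j0 fj0]|nofrac] := pselect (exists j, (0 < s j < 1)%R); last first.
  apply: bl_bound_extreme => // j; have [s01 _ _] := feas.
  have /andP[] := s01 j; rewrite !le_eqVlt => /predU1P[<-|s0]; first by left.
  move=> /predU1P[->|s1]; first by right.
  by exfalso; apply: nofrac; exists j; rewrite s0.
have [j0n0|j0n0] := eqVneq (nj j0) 0%N.
  apply: (bl_bound_perturb (d := fun j => (j == j0)%:R)%R) => //.
  - by move=> j; have [->//|_] := eqVneq j j0; rewrite eqxx.
  - by exists j0; rewrite eqxx oner_neq0.
  - move=> s' _ _; rewrite (bigD1 j0)//= big1 => [|j /negbTE ->]; last by rewrite mul0r.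
    by rewrite j0n0 mulr0 addr0 eqxx.
have nj0 : (0 < nj j0)%N by rewrite lt0n.
have [[j1 [j1j0 fj1]]|uniq] := pselect (exists j, j != j0 /\ (0 < s j < 1)%R).
  (* This direction keeps s_j0 n_j0 + s_j1 n_j1 constant. It is nonzero at [j1] since n_j0 > 0; at
     [j0] it may vanish. *)
  pose d j : R := if j == j0 then (nj j1)%:R else if j == j1 then (- (nj j0)%:R)%R else 0%R.
  apply: (bl_bound_perturb (d := d)) => //.
  - move=> j; rewrite /d; have [->//|_] := eqVneq j j0.
    by have [->//|_] := eqVneq j j1; rewrite eqxx.
  - by exists j1; rewrite /d (negbTE j1j0) eqxx oppr_eq0 pnatr_eq0 -lt0n.
  - move=> s' _ _; rewrite (bigD1 j0)//= (bigD1 j1)//= big1 => [|j /andP[jj0 jj1]]; last first.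
      by rewrite /d (negbTE jj0) (negbTE jj1) mul0r.
    by rewrite /d eqxx (negbTE j1j0) eqxx addr0 mulNr mulrC subrr eqxx.
apply: (bl_bound_perturb (d := fun j => (j == j0)%:R)%R) => //.
- by move=> j; have [->//|_] := eqVneq j j0; rewrite eqxx.
- by exists j0; rewrite eqxx oner_neq0.
- move=> s' feas' s's _ s'sum s'frac.
  apply: (single_fractional_tight (j0 := j0)) => //.
    by apply: s'frac; rewrite eqxx oner_neq0.
  move=> j jj0; rewrite s's ?(negbTE jj0)//.
  have [s01 _ _] := feas; have /andP[] := s01 j.
  rewrite !le_eqVlt => /predU1P[<-|sj0]; first by left.
  move=> /predU1P[->|sj1]; first by right.
  by exfalso; apply: uniq; exists j; rewrite sj0.
Qed.

(** * Necessity of the dimension conditions *)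

Lemma powR_le_asymptotic (p q K t0 : R) :
  (forall t, (t0 <= t)%R -> (t `^ p <= K * t `^ q)%R) -> (p <= q)%R.
Proof.
move=> H; rewrite leNgt; apply/negP => qp.
have pq0 : (0 < p - q)%R by rewrite subr_gt0.
pose t := (Num.max t0 1 + (`|K| + 1) `^ (p - q)^-1)%R.
have K1 : (0 < `|K| + 1 :> R)%R by rewrite ltr_pwDr.
have tge : ((`|K| + 1) `^ (p - q)^-1 <= t)%R.
  by rewrite lerDr (le_trans ler01)// le_max lexx orbT.
have t1 : (0 < t)%R by apply: lt_le_trans tge; exact: powR_gt0.
have tt0 : (t0 <= t)%R.
  by rewrite (@le_trans _ _ (Num.max t0 1%R))// ?le_max ?lexx// lerDl powR_ge0.
have := H t tt0; rewrite leNgt => /negP; apply.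
rewrite -[X in (_ < _ `^ X)%R](subrK q) powRD ?(gt_eqF t1) ?implybT//.
rewrite ltr_pM2r ?powR_gt0//.
apply: (@lt_le_trans _ _ (`|K| + 1)%R); first by rewrite ltr_pwDr// ler_norm.
have -> : (`|K| + 1 = ((`|K| + 1) `^ (p - q)^-1) `^ (p - q))%R.
  by rewrite -powRrM mulVf ?gt_eqF// powRr1// ltW.
by rewrite ge0_ler_powR// ?nnegrE ?powR_ge0// ltW.
Qed.

Lemma prod_powR (m : nat) (x : R) (e : 'I_m -> R) : (0 < x)%R ->
  (\prod_j x `^ e j = x `^ (\sum_j e j))%R.
Proof.
move=> x0; apply/esym; apply: (big_morph (fun e => x `^ e)%R) => [a b|]; last exact: powRr0.
by rewrite powRD// (gt_eqF x0) implybT.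
Qed.

Definition split_box a b n (G : 'M[R]_(n, a)) (K : 'M[R]_(n, b)) (r rho : R) : set (T n) :=
  [set x | box r (linear_map G x) /\ box rho (linear_map K x)].

Lemma measurable_split_box a b n (G : 'M[R]_(n, a)) (K : 'M[R]_(n, b)) r rho :
  measurable (split_box G K r rho).
Proof.
rewrite (_ : split_box _ _ _ _ =
  (linear_map G @^-1` box r) `&` (linear_map K @^-1` box rho))//.
by apply: measurableI; rewrite -[X in measurable X]setTI;
  apply: measurable_linear_map => //; exact: measurable_box.
Qed.

Lemma split_box_volume a b n (V : 'M[R]_(a, n)) (W : 'M[R]_(b, n))
    (G : 'M[R]_(n, a)) (K : 'M[R]_(n, b)) : split_basis V W G K ->
  exists2 c : R, (0 < c)%R & forall r rho, (0 < r)%R -> (0 < rho)%R ->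
    lam n (split_box G K r rho) = (c * (r `^ a%:R * rho `^ b%:R))%:E.
Proof.
move=> sp; have [c c0 Hc] := ge0_integral_split sp.
exists (c * (2 ^+ a * 2 ^+ b))%R; first by rewrite !mulr_gt0// exprn_gt0.
move=> r rho r0 rho0; have mS := measurable_split_box G K r rho.
rewrite measureEintegral// Hc; [|exact: measurable_EFin_indic|exact: EFin_indic_ge0].
have E x y : ((\1_(split_box G K r rho) (affine2 V W 0 x y))%:E =
    (\1_(box rho) y)%:E * (\1_(box r) x)%:E :> \bar R).
  case: sp => VG VK WG WK _.
  rewrite -EFinM; congr EFin; rewrite !indicE -natrM mulnb; congr (nat_of_bool _)%:R.
  have -> : (affine2 V W 0 x y \in split_box G K r rho) =
      (linear_map G (affine2 V W 0 x y) \in box r) && (linear_map K (affine2 V W 0 x y) \in box rho).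
    by apply/idP/andP => [|[]]; rewrite !inE; [case|split].
  rewrite /linear_map /affine2 tuple_of_rowK addr0 !mulmxDl -!mulmxA VG VK WG WK.
  by rewrite !mulmx1 !mulmx0 addr0 add0r !row_ofK andbC.
transitivity (c%:E * \int[lam b]_y ((\1_(box rho) y : R)%:E * lam a (box r))).
  congr (_ * _); apply: eq_integral => y _; under eq_integral do rewrite E.
  rewrite ge0_integralZl//.
    by rewrite -measureEintegral//; exact: measurable_box.
  by apply: measurable_EFin_indic; exact: measurable_box.
rewrite ge0_integralZr//; last first.
  by apply: measurable_EFin_indic; exact: measurable_box.
rewrite -measureEintegral; last exact: measurable_box.
rewrite (lebesgue_tuple_box a (ltW r0)) [X in _ * (X * _)](lebesgue_tuple_box b (ltW rho0)).
rewrite -!EFinM.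
by rewrite !powR_mulrn ?ltW// !exprMn; congr EFin; ring.
Qed.

Section Necessity.
Variables (n k m : nat) (nj : 'I_m -> nat) (L0 : 'M[R]_(n, k)).
Variables (L : forall j, 'M[R]_(n, nj j)) (s : 'I_m -> R) (C de : R).
Hypothesis s0 : forall j, (0 <= s j)%R.
Hypothesis C0 : (0 <= C)%R.
Hypothesis de0 : (0 < de)%R.
(** The inequality tested on indicators: [S] lies in the region of the cut-off, and [Sj j] contains
    its image. For small [de] the cube of half-side [de] in H_0 lies in the unit ball. *)
Hypothesis bound : forall (S : set (T n)) (Sj : forall j, set (T (nj j))),
  measurable S -> (forall j, measurable (Sj j)) ->
  (forall x, S x -> box de (linear_map L0 x)) ->
  (forall j x, S x -> Sj j (linear_map (L j) x)) ->
  lam n S <= C%:E * \prod_j (lam (nj j) (Sj j)) `^ s j.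

Variables (u : nat) (V : 'M[R]_(u, n)).

Let Vb := row_base V.
Let Wb := row_base V^C%MS.
Let G := coord_in V.
Let K := coord_out V.
Let Gj j := coord_in (V *m L j).
Let Kj j := coord_out (V *m L j).

Let A := (\sum_j s j * (\rank (V *m L j))%:R)%R.
Let B := (\sum_j s j * (\rank (V *m L j)^C%MS)%:R)%R.

(** A common bound for the norms of all blocks, so that one factor enlarges every image box. *)
Let N : R := (1 + mx_norm1 (Vb *m L0) + mx_norm1 (Wb *m L0) +
  \sum_j (mx_norm1 (Vb *m L j *m Gj j) + mx_norm1 (Wb *m L j *m Gj j) +
          mx_norm1 (Wb *m L j *m Kj j)))%R.

Let sum_term_ge0 j : (0 <= mx_norm1 (Vb *m L j *m Gj j) + mx_norm1 (Wb *m L j *m Gj j) +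
          mx_norm1 (Wb *m L j *m Kj j))%R.
Proof. by rewrite !addr_ge0// mx_norm1_ge0. Qed.

Let N_ge j : [/\ (mx_norm1 (Vb *m L j *m Gj j) <= N)%R, (mx_norm1 (Wb *m L j *m Gj j) <= N)%R
  & (mx_norm1 (Wb *m L j *m Kj j) <= N)%R].
Proof.
have := mx_norm1_ge0 (Vb *m L0); have := mx_norm1_ge0 (Wb *m L0).
have := mx_norm1_ge0 (Vb *m L j *m Gj j); have := mx_norm1_ge0 (Wb *m L j *m Gj j).
have := mx_norm1_ge0 (Wb *m L j *m Kj j).
rewrite /N (bigD1 j)//=; set z := (\sum_(i | _) _)%R.
have : (0 <= z)%R by apply: sumr_ge0 => i _; exact: sum_term_ge0.
by move=> ? ? ? ? ? ?; split; lra.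
Qed.

Let N_ge0 : [/\ (1 <= N)%R, (mx_norm1 (Vb *m L0) <= N)%R & (mx_norm1 (Wb *m L0) <= N)%R].
Proof.
have := mx_norm1_ge0 (Vb *m L0); have := mx_norm1_ge0 (Wb *m L0).
rewrite /N; set z := (\sum_i _)%R.
have : (0 <= z)%R by apply: sumr_ge0 => i _; exact: sum_term_ge0.
by move=> ? ? ?; split; lra.
Qed.

Let row_le2 a b p (M1 : 'M[R]_(a, p)) (M2 : 'M[R]_(b, p)) (x : 'rV[R]_a) (y : 'rV[R]_b)
    (r rho m1 m2 : R) i :
  (0 <= r)%R -> (0 <= rho)%R -> (forall k, `|x ord0 k| <= r)%R ->
  (forall k, `|y ord0 k| <= rho)%R -> (mx_norm1 M1 <= m1)%R -> (mx_norm1 M2 <= m2)%R ->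
  (`|(x *m M1 + y *m M2) ord0 i| <= r * m1 + rho * m2)%R.
Proof.
move=> r0 rho0 xr yr h1 h2; rewrite mxE (le_trans (ler_normD _ _))// lerD//.
  by apply: le_trans (row_mul_le _ _ r0 xr) _; exact: ler_wpM2l.
by apply: le_trans (row_mul_le _ _ rho0 yr) _; exact: ler_wpM2l.
Qed.

(** A box of half-sides [r] along V and [rho] along a complement is mapped by [L j] into a box of
    half-sides (r + rho) N along L_j V and rho N transversally, because V contributes nothing in the
    transversal directions. The constraint keeps the box inside the cut-off; it leaves [r] free when
    V lies in the kernel of [L0]. *)
Let box_inequality : exists c K1 : R, [/\ (0 < c)%R, (0 <= K1)%R &
  forall r rho, (0 < r)%R -> (0 < rho)%R ->
    (r * mx_norm1 (Vb *m L0) + rho * N <= de)%R ->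
    (c * (r `^ (\rank V)%:R * rho `^ (\rank V^C%MS)%:R) <= K1 * ((r + rho) `^ A * rho `^ B))%R].
Proof.
have [c c0 Hc] := split_box_volume (split_mxP V).
have /choice[cj Hcj] : forall j, exists c : R, (0 < c)%R /\
    forall r rho, (0 < r)%R -> (0 < rho)%R ->
    lam (nj j) (split_box (Gj j) (Kj j) r rho) =
    (c * (r `^ (\rank (V *m L j))%:R * rho `^ (\rank (V *m L j)^C%MS)%:R))%:E.
  by move=> j; have [c' ? ?] := split_box_volume (split_mxP (V *m L j)); exists c'.
have [N1 NV NW] := N_ge0.
have N0 : (0 < N)%R by apply: lt_le_trans N1.
exists c, (C * \prod_j (cj j `^ s j) * (N `^ A * N `^ B))%R; split => //.
  by rewrite !mulr_ge0 ?powR_ge0// prodr_ge0// => j _; exact: powR_ge0.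
move=> r rho r0 rho0 hde.
have rr0 : (0 < r + rho)%R by exact: addr_gt0.
rewrite -lee_fin -Hc//.
apply: le_trans (bound (Sj := fun j => split_box (Gj j) (Kj j) ((r + rho) * N) (rho * N)) _ _ _ _) _.
- exact: measurable_split_box.
- by move=> j; exact: measurable_split_box.
- move=> x [xG xK] i; rewrite tnth_mktuple.
  rewrite (split_decomp (split_mxP V) (row_of x)) mulmxDl -!(mulmxA (row_of x *m _)).
  apply: le_trans (row_le2 _ (ltW r0) (ltW rho0) _ _ (lexx _) NW) hde => l.
    by have := xG l; rewrite tnth_mktuple.
  by have := xK l; rewrite tnth_mktuple.
- move=> j x [xG xK]; have [Nj1 Nj2 Nj3] := N_ge j.
  have xG' l : (`|(row_of x *m G) ord0 l| <= r)%R by have := xG l; rewrite tnth_mktuple.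
  have xK' l : (`|(row_of x *m K) ord0 l| <= rho)%R by have := xK l; rewrite tnth_mktuple.
  split => i; rewrite tnth_mktuple tuple_of_rowK.
    rewrite (split_decomp (split_mxP V) (row_of x)) !mulmxDl -!(mulmxA (row_of x *m _)).
    rewrite mulrDl; exact: row_le2 (ltW r0) (ltW rho0) xG' xK' Nj1 Nj2.
  rewrite (split_decomp (split_mxP V) (row_of x)) !mulmxDl -!(mulmxA (row_of x *m _)).
  have -> : row_base V *m L j *m Kj j = 0%R.
    have : (row_base V *m L j <= row_base (V *m L j))%MS.
      by rewrite eq_row_base submxMr// eq_row_base.
    move=> /submxP[Q ->]; case: (split_mxP (V *m L j)) => _ VK _ _ _.
    by rewrite -mulmxA VK mulmx0.
  rewrite mulmx0 add0r; apply: le_trans (row_mul_le _ _ (ltW rho0) xK') _.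
  by apply: ler_wpM2l => //; exact: ltW.
rewrite /=; under eq_bigr => j _.
  rewrite (proj2 (Hcj j)) ?mulr_gt0// poweR_EFin.
  have cj0 := proj1 (Hcj j).
  rewrite !powRM ?mulr_ge0 ?powR_ge0 ?(ltW cj0) ?(ltW rr0) ?(ltW rho0) ?(ltW N0)//.
  rewrite -!powRrM.
  over.
rewrite prodEFin -EFinM lee_fin.
rewrite !big_split/= !prod_powR//.
rewrite le_eqVlt; apply/orP; left; apply/eqP.
have -> : (\sum_i (\rank (V *m L i))%:R * s i = A)%R by apply: eq_bigr => j _; rewrite mulrC.
have -> : (\sum_i (\rank (V *m L i)^C%MS)%:R * s i = B)%R by apply: eq_bigr => j _; rewrite mulrC.
by ring.
Qed.

(** Keep rho fixed and let r = t tend to infinity: once t >= rho, r + rho <= 2t, and the powers of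
    [t] are compared. *)
Lemma necessary_ker : V *m L0 = 0%R -> ((\rank V)%:R <= A)%R.
Proof.
move=> VL0; have [c [K1 [c0 K10 H]]] := box_inequality.
have VbL0 : Vb *m L0 = 0%R.
  have /submxP[Q ->] : (Vb <= V)%MS by rewrite eq_row_base.
  by rewrite -mulmxA VL0 mulmx0.
have nV0 : mx_norm1 (Vb *m L0) = 0%R.
  by rewrite VbL0 /mx_norm1 big1// => i _; rewrite big1// => j _; rewrite mxE normr0.
have [N1 _ _] := N_ge0; have N0 : (0 < N)%R by apply: lt_le_trans N1.
pose ep := (de / N)%R; have ep0 : (0 < ep)%R by rewrite divr_gt0.
have A0 : (0 <= A)%R by apply: sumr_ge0 => j _; rewrite mulr_ge0.
pose D := (c * ep `^ (\rank V^C%MS)%:R)%R; have D0 : (0 < D)%R by rewrite mulr_gt0// powR_gt0.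
apply: (@powR_le_asymptotic _ _ (D^-1 * (K1 * (2 `^ A * ep `^ B))) ep) => t ept.
have t0 : (0 < t)%R by apply: lt_le_trans ept.
have := H t ep t0 ep0; rewrite nV0 mulr0 add0r divfK ?gt_eqF// lexx => /(_ isT) Ht.
rewrite -mulrA ler_pdivlMl//.
apply: (@le_trans _ _ (K1 * ((t + ep) `^ A * ep `^ B))%R).
  by apply: le_trans Ht; rewrite /D le_eqVlt; apply/orP; left; apply/eqP; ring.
rewrite -!mulrA; apply: ler_wpM2l => //.
rewrite [X in (_ <= _ * X)%R]mulrC mulrA; apply: ler_wpM2r; first exact: powR_ge0.
rewrite -powRM//; last exact: ltW.
apply: ge0_ler_powR => //; rewrite ?nnegrE.
- by rewrite addr_ge0 ?ltW.
- by rewrite mulr_ge0 ?ltW.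
- by rewrite mulr_natl mulr2n lerD2l.
Qed.

(** Keep r fixed and let rho = 1/t tend to 0; comparing powers of [t] reverses the sign of the
    exponents. *)
Lemma necessary_codim :
  (\sum_j s j * ((nj j)%:R - (\rank (V *m L j))%:R) <= n%:R - (\rank V)%:R)%R.
Proof.
have [c [K1 [c0 K10 H]]] := box_inequality.
have [N1 NV _] := N_ge0; have N0 : (0 < N)%R by apply: lt_le_trans N1.
(* Both half-sides are at most [ep], and each of the two contributions to the constraint is at most
   [ep * N], half of [de]. *)
pose ep := (de / (2 * N))%R; have ep0 : (0 < ep)%R by rewrite divr_gt0// mulr_gt0.
have A0 : (0 <= A)%R by apply: sumr_ge0 => j _; rewrite mulr_ge0.
have -> : (n%:R - (\rank V)%:R = (\rank V^C%MS)%:R :> R)%R.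
  by rewrite mxrank_compl natrB// rank_leq_col.
have -> : (\sum_j s j * ((nj j)%:R - (\rank (V *m L j))%:R) = B)%R.
  by apply: eq_bigr => j _; rewrite mxrank_compl natrB// rank_leq_col.
pose D := (c * ep `^ (\rank V)%:R)%R; have D0 : (0 < D)%R by rewrite mulr_gt0// powR_gt0.
rewrite -lerN2.
apply: (@powR_le_asymptotic _ _ (D^-1 * (K1 * (2 * ep) `^ A)) ep^-1) => t ept.
have t0 : (0 < t)%R by apply: lt_le_trans ept; rewrite invr_gt0.
have ti0 : (0 < t^-1)%R by rewrite invr_gt0.
have tep : (t^-1 <= ep)%R by rewrite -[leRHS]invrK lef_pV2 ?posrE ?invr_gt0.
have E p : (t `^ (- p) = t^-1 `^ p)%R.
  by rewrite -powR_inv1 ?ltW// -powRrM mulN1r.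
rewrite !E -mulrA ler_pdivlMl//.
have {}H := H ep t^-1%R ep0 ti0.
apply: (@le_trans _ _ (K1 * ((ep + t^-1) `^ A * t^-1 `^ B))%R).
  apply: le_trans (H _); last first.
    apply: (@le_trans _ _ (ep * N + ep * N)%R).
      by apply: lerD; [apply: ler_wpM2l => //; exact: ltW|apply: ler_wpM2r => //; exact: ltW].
    rewrite le_eqVlt; apply/orP; left; apply/eqP; rewrite /ep.
    by field; rewrite gt_eqF.
  by rewrite /D le_eqVlt; apply/orP; left; apply/eqP; ring.
rewrite -!mulrA; apply: ler_wpM2l => //; apply: ler_wpM2r; first exact: powR_ge0.
apply: ge0_ler_powR => //; rewrite ?nnegrE.
- by rewrite addr_ge0 ?ltW.
- by rewrite mulr_ge0 ?ltW.
- by rewrite mulr_natl mulr2n lerD2l.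
Qed.

End Necessity.

(** * Orthonormal coordinates on Hilbert spaces *)

Lemma onb_basis (E : hilbertType R) : basis_of fullv (onb E).
Proof. exact: (onbP E).1. Qed.

Section Coordinates.
Variable E : hilbertType R.
Let e := onb E.
Let e_basis : basis_of fullv e := (onbP E).1.

Lemma onb_coordsE v : onb_coords v = tuple_of_row (rVof e v).
Proof.
by apply: eq_from_tnth => i; rewrite !tnth_mktuple mxE.
Qed.

Lemma row_of_onb_coords v : row_of (onb_coords v) = rVof e v.
Proof. by rewrite onb_coordsE tuple_of_rowK. Qed.

Definition of_coords (t : T (\dim {:E})) : E := vecof e (row_of t).

Lemma of_coordsK : cancel of_coords (@onb_coords R E).
Proof. by move=> t; rewrite onb_coordsE /of_coords vecofK// row_ofK. Qed.

Lemma hnorm_sqr v : (hnorm v ^+ 2 = \sum_i rVof e v ord0 i ^+ 2)%R.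
Proof.
rewrite sqr_sqrtr; last first.
  by have [->|v0] := eqVneq v 0%R; [rewrite linear0r|exact/ltW/neq0_dnorm_gt0].
have coordE i : inner (tnth e i) v = rVof e v ord0 i.
  rewrite -{1}(rVofK e_basis v) /vecof linear_sumr/= (bigD1 i)//= linearZr_LR/=.
  rewrite -tnth_nth (onbP E).2 eqxx mulr1 big1 ?addr0// => j ji.
  by rewrite linearZr_LR/= -tnth_nth (onbP E).2 eq_sym (negbTE ji) mulr0.
rewrite -{2}(rVofK e_basis v) /vecof linear_sumr/=; apply: eq_bigr => i _.
rewrite linearZr_LR/= -tnth_nth expr2 -coordE; congr (_ * _)%R.
by rewrite (hermC (inner : {dot E for idfun})) expr0 mul1r.
Qed.

Definition spans (U : {vspace E}) u (V : 'M[R]_(u, \dim {:E})) : Prop :=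
  forall v, (v \in U) = (rVof e v <= V)%MS.

Lemma spans_dim U u (V : 'M[R]_(u, \dim {:E})) : spans U V -> \dim U = \rank V.
Proof.
move=> UV; pose b := [tuple vecof e (row i (row_base V)) | i < \rank V].
have bE (i : 'I_(\rank V)) : b`_i = vecof e (row i (row_base V)) by rewrite -tnth_nth tnth_mktuple.
have comb (x : 'rV[R]_(\rank V)) :
    (\sum_i x ord0 i *: b`_i = vecof e (x *m row_base V))%R.
  rewrite mulmx_sum_row linear_sum/=; apply: eq_bigr => i _.
  by rewrite linearZ/= bE.
have bU : U = <<b>>%VS.
  apply/eqP; rewrite eqEsubv; apply/andP; split; apply/subvP => v.
    rewrite UV -(eq_row_base V) => /submxP[x vE].
    rewrite -(rVofK e_basis v) vE -comb; apply: memv_suml => i _.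
    by rewrite memvZ// memv_span// mem_nth// size_tuple.
  apply/subvP/span_subvP => w /tnthP[i ->]; rewrite tnth_mktuple UV vecofK//.
  by rewrite -(eq_row_base V) row_sub.
have bF : free b.
  apply/freeP => x x0 i; have := comb (\row_i x i).
  under eq_bigr do rewrite mxE.
  rewrite x0 => /esym/eqP; rewrite vecof_eq0//.
  rewrite mulmx_free_eq0 ?row_base_free// => /eqP/rowP/(_ i).
  by rewrite !mxE.
by move: bF; rewrite bU => /eqP ->; rewrite size_tuple.
Qed.

Lemma spans_vsof u (V : 'M[R]_(u, \dim {:E})) : spans (vsof e <<V>>%MS) V.
Proof. by move=> v; rewrite -rVof_sub// genmxE. Qed.

Lemma spans_msof U : spans U (msof e U).
Proof. by move=> v; rewrite -mem_vecof// rVofK. Qed.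

End Coordinates.

Definition lin_mx (E F : hilbertType R) (l : 'Hom(E, F)) : 'M[R]_(_, _) :=
  mxof (onb E) (onb F) l.

Section LinearCoordinates.
Variables (E F : hilbertType R) (l : 'Hom(E, F)).

Lemma onb_coords_lin v : onb_coords (l v) = linear_map (lin_mx l) (onb_coords v).
Proof.
by rewrite /linear_map row_of_onb_coords onb_coordsE (rVof_app _ (onb_basis E)).
Qed.

Lemma spans_limg (U : {vspace E}) u (V : 'M[R]_(u, \dim {:E})) :
  spans U V -> spans (l @: U)%VS (V *m lin_mx l).
Proof.
move=> UV w; apply/memv_imgP/submxP => [[v vU ->]|[D wE]].
  move: vU; rewrite UV => /submxP[D vE]; exists D.
  by rewrite (rVof_app _ (onb_basis E)) vE mulmxA.
exists (vecof (onb E) (D *m V)).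
  by rewrite UV vecofK ?submxMl//; exact: (onbP E).1.
rewrite (@hom_vecof _ _ _ (onb E) (onb F)) ?onb_basis// -mulmxA -wE rVofK// onb_basis.
by [].
Qed.

Lemma spans_lker (U : {vspace E}) u (V : 'M[R]_(u, \dim {:E})) :
  spans U V -> (U <= lker l)%VS <-> V *m lin_mx l = 0%R.
Proof.
move=> UV; have rE := spans_dim (spans_limg UV).
rewrite lkerE -dimv_eq0 rE mxrank_eq0; by split => /eqP.
Qed.

Lemma lin_mx_full : (forall z, exists y, l y = z) -> row_full (lin_mx l).
Proof.
move=> surj; have := spans_dim (spans_limg (spans_msof {:E}%VS)).
have -> : (l @: {:E} = {:F})%VS.
  apply/eqP; rewrite eqEsubv subvf/=; apply/subvP => z _.
  by have [y <-] := surj z; rewrite memv_img ?memvf.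
move=> dE; rewrite /row_full eqn_leq rank_leq_col/=.
by apply: leq_trans (mxrankM_maxr (msof (onb E) fullv) _); rewrite -dE.
Qed.

End LinearCoordinates.

(** * The completed Lebesgue measure in coordinates *)

Section LebesgueLink.
Variable E : hilbertType R.
Local Notation n := (\dim {:E}).
Local Notation co := (@onb_coords R E : lebesgue_space E -> T n).

Lemma image_onb_coords (X : set E) (B : set (T n)) :
  @onb_coords R E @` (X `&` @onb_coords R E @^-1` B) = @onb_coords R E @` X `&` B.
Proof.
apply/seteqP; split => [_ [x [Xx Bx] <-]|t [[x Xx <-] Bx]]; first by split => //; exists x.
by exists x.
Qed.

Lemma lebesgue_preimage (B : set (T n)) : measurable B ->
  lebesgue E (co @^-1` B) = lam n B.
Proof.
move=> mB; rewrite /lebesgue /lebesgue_outer -[X in _ @` X]setTI image_onb_coords.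
rewrite (_ : _ @` setT = setT) ?setTI ?measurable_mu_extE//.
by apply/seteqP; split => // t _; exists (of_coords t); rewrite ?of_coordsK.
Qed.

Lemma measurable_onb_coords : measurable_fun [set: lebesgue_space E] co.
Proof.
move=> _ B mB; rewrite setTI.
suff : caratheodory_measurable (@lebesgue_outer R E) (@onb_coords R E @^-1` B) by [].
move=> X.
rewrite /lebesgue_outer image_onb_coords preimage_setC image_onb_coords.
exact: (caratheodory_measurable_mu_ext (lam n) mB).
Qed.

Lemma lebesgue_integral_coords (g : T n -> \bar R) (D : set (T n)) :
  measurable D -> measurable_fun setT g -> (forall x, 0 <= g x) ->
  \int[lebesgue E]_(y in co @^-1` D) g (co y) = \int[lam n]_(x in D) g x.
Proof.
move=> mD mg g0.
rewrite -(@ge0_integral_pushforward _ _ _ _ R _ measurable_onb_coords (lebesgue E) D g)//;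
  last exact: measurable_funTS.
apply: eq_measure_integral => [|mc A mA _]; first exact: measurable_onb_coords.
by transitivity (lebesgue E (co @^-1` A)) => //; exact: lebesgue_preimage.
Qed.

(** Intersect countable measurable covers whose measures exceed the outer measure by at most
    1/(k+1). *)
Lemma outer_hull q (X : set (T q)) : ((lam q)^*)%mu X < +oo ->
  exists B : set (T q), [/\ measurable B, X `<=` B & lam q B <= ((lam q)^*)%mu X].
Proof.
move=> Xoo.
have Xfin : ((lam q)^*)%mu X \is a fin_num by rewrite ge0_fin_numE// outer_measure_ge0.
have /choice[B HB] : forall k : nat, exists B : set (T q), [/\ measurable B, X `<=` B &
    lam q B <= ((lam q)^*)%mu X + (k.+1%:R^-1)%:E].
  move=> k; have : ((lam q)^*)%mu X < ((lam q)^*)%mu X + (k.+1%:R^-1)%:E.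
    by rewrite lteDl// lte_fin invr_gt0.
  rewrite {1}/mu_ext => /ereal_inf_lt[_ [F [mF XF] <-]] lt.
  exists (\bigcup_i F i); split => //; first exact: bigcup_measurable.
  apply: le_trans (ltW lt); apply: measure_sigma_subadditive => //.
  exact: bigcup_measurable.
exists (\bigcap_k B k); split.
- by apply: bigcapT_measurable => k; case: (HB k).
- by move=> x Xx k _; case: (HB k) => _ /(_ _ Xx).
- apply/lee_addgt0Pr => e e0.
  have [k ke] : exists k : nat, (k.+1%:R^-1 <= e)%R.
    exists (Num.truncn e^-1)%R; rewrite invf_ple ?posrE//.
    by rewrite ltW// truncnS_gt.
  have [mB XB LB] := HB k.
  apply: (@le_trans _ _ (lam q (B k))).
    apply: le_measure; rewrite ?inE//; last by move=> x; exact.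
    by apply: bigcapT_measurable => i; case: (HB i).
  by apply: le_trans LB _; rewrite leeD2l// lee_fin.
Qed.

(** The pieces of [A] in the boxes of half-side k have finite measure, so a Borel hull of the same
    measure differs from each by a null set; the union of these hulls serves for [A]. *)
Lemma lebesgue_hull (A : set (lebesgue_space E)) : measurable A ->
  exists B : set (T n), [/\ measurable B, A `<=` co @^-1` B &
    lebesgue E ((co @^-1` B) `\` A) = 0].
Proof.
move=> mA.
pose A_ (k : nat) := A `&` co @^-1` (box k%:R).
have mco B : measurable B -> measurable (co @^-1` B).
  by move=> mB; rewrite -[X in measurable X]setTI; exact: measurable_onb_coords.
have mA_ k : measurable (A_ k).
  by apply: measurableI => //; apply: mco; exact: measurable_box.
have A_oo k : lebesgue E (A_ k) < +oo.
  apply: (@le_lt_trans _ _ (lebesgue E (co @^-1` (box k%:R)))).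
    apply: le_measure; rewrite ?inE//; first by apply: mco; exact: measurable_box.
    exact: subIsetr.
  by rewrite lebesgue_preimage ?lebesgue_tuple_box ?ltry//; exact: measurable_box.
have /choice[B HB] : forall k : nat, exists B : set (T n),
    [/\ measurable B, A_ k `<=` co @^-1` B & lebesgue E ((co @^-1` B) `\` A_ k) = 0].
  move=> k; have [B [mB XB LB]] := outer_hull (A_oo k).
  exists B; split => //; first by move=> x Ax; apply: XB; exists x.
  have AB : A_ k `<=` co @^-1` B by move=> x Ax; apply: XB; exists x.
  have LBE : lebesgue E (co @^-1` B) <= lebesgue E (A_ k).
    by rewrite lebesgue_preimage.
  have := measureD (mu := lebesgue E) (mco _ mB) (mA_ k) (le_lt_trans LBE (A_oo k)).
  rewrite (setIidr AB) => ->.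
  rewrite [X in X - _](_ : _ = lebesgue E (A_ k)); last first.
    by apply/eqP; rewrite eq_le LBE/= le_measure// inE//; exact: mco.
  by rewrite subee// ge0_fin_numE.
exists (\bigcup_k B k); split.
- by apply: bigcup_measurable => k _; case: (HB k).
- move=> x Ax; have [k0 xk] := box_exhausts (co x).
  by exists k0 => //; case: (HB k0) => _ + _; apply; split => //; exact: xk.
have mB : measurable (\bigcup_k B k) by apply: bigcup_measurable => k _; case: (HB k).
apply/(negligibleP (lebesgue E)); first by apply: measurableD => //; exact: mco.
apply: (@negligibleS _ _ _ _ (\bigcup_k ((co @^-1` (B k)) `\` A_ k))).
  by move=> x [[k _ Bx] Ax]; exists k => //; split => // -[].
apply: negligible_bigcup => k; have [mBk _ B0] := HB k.
by apply/negligibleP => //; apply: measurableD => //; exact: mco.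
Qed.

End LebesgueLink.

(** Split along the kernel of [L]: on a complement [L] is an isomorphism, and the preimage is a null
    set times the kernel. It transports the exceptional sets of the majorants back to H. *)
Lemma null_preimage n q (L : 'M[R]_(n, q)) (N : set (T q)) : row_full L ->
  measurable N -> lam q N = 0 -> lam n (linear_map L @^-1` N) = 0.
Proof.
move=> fL mN N0; pose V := kermx L.
have [c c0 Hc] := ge0_integral_split (split_mxP V).
have VL : row_base V *m L = 0%R.
  have /submxP[Q ->] : (row_base V <= V)%MS by rewrite eq_row_base.
  by rewrite -mulmxA mulmx_ker mulmx0.
pose M := row_base V^C%MS *m L.
have rM : \rank M = q.
  have LE : L = coord_out V *m M.
    have := split_decomp (split_mxP V) 1%:M; rewrite !mul1mx => /(congr1 (mulmx^~ L)).
    by rewrite mul1mx mulmxDl -(mulmxA (coord_in V)) -(mulmxA (coord_out V)) VL mulmx0 add0r.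
  apply/eqP; rewrite eqn_leq rank_leq_col.
  by have := mxrankM_maxr (coord_out V) M; rewrite -LE (eqP fL).
have rV : \rank V^C%MS = q.
  rewrite mxrank_compl /V mxrank_ker (eqP fL).
  by have := rank_leq_row L; rewrite (eqP fL); lia.
have [c' c'0 Hc'] : exists2 c : R, (0 < c)%R & forall f : T q -> \bar R,
    measurable_fun setT f -> (forall x, 0 <= f x) ->
    \int[lam (\rank V^C%MS)]_y f (linear_map M y) = c%:E * \int[lam q]_z f z.
  by apply: ge0_integral_linear_iso; apply/eqP; rewrite rM// rV.
have mLN : measurable (linear_map L @^-1` N).
  by rewrite -[X in measurable X]setTI; exact: measurable_linear_map.
rewrite measureEintegral// Hc; last 2 first.
- exact: measurable_EFin_indic.
- exact: EFin_indic_ge0.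
have E x y : (\1_(linear_map L @^-1` N) (affine2 (row_base V) (row_base V^C%MS) 0 x y))%:E =
    (\1_N (linear_map M y) : R)%:E :> \bar R.
  congr (_%:R%:E); congr nat_of_bool; apply/idP/idP; rewrite !inE /=;
  rewrite /linear_map /affine2 tuple_of_rowK addr0 mulmxDl;
  by rewrite -(mulmxA (row_of x)) -(mulmxA (row_of y)) VL mulmx0 add0r.
(* The kernel may have infinite measure; this is harmless as 0 * +oo = 0. *)
under eq_integral => y _.
  under eq_integral do rewrite E.
  rewrite integral_cst//; over.
rewrite ge0_integralZr//; last first.
  apply: (measurableT_comp (f := fun z => (\1_N z : R)%:E)); last exact: measurable_linear_map.
  exact: measurable_EFin_indic.
rewrite (Hc' (fun z => (\1_N z : R)%:E)); last 2 first.
- exact: measurable_EFin_indic.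
- exact: EFin_indic_ge0.
have I0 : \int[lam q]_z (\1_N z : R)%:E = 0 by rewrite -[RHS]N0 (measureEintegral _ mN).
by rewrite I0 mule0 mul0e mule0.
Qed.

(** * Borel majorants of Lebesgue measurable functions and their norms *)

Section Majorant.
Variable E : hilbertType R.
Local Notation n := (\dim {:E}).
Local Notation co := (@onb_coords R E : lebesgue_space E -> T n).

(* A majorant, unlike a mere Borel function a.e. equal to [f], bounds the integrand of the
   theorem everywhere, so the measurability of [f j \o l j] is never needed. *)
Definition borel_majorant (f : lebesgue_space E -> R) (g : T n -> \bar R) : Prop :=
  [/\ measurable_fun setT g, forall t, 0 <= g t, forall y, (f y)%:E <= g (co y) &
    {ae lebesgue E, forall y, g (co y) = (f y)%:E}].

(** A nonnegative [f] is the supremum of q 1_{f > q} over nonnegative rationals q. Replacing each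
    level set by its Borel hull enlarges the supremum, and only on a countable union of null
    sets. *)
Lemma exists_borel_majorant (f : lebesgue_space E -> R) :
  measurable_fun [set: lebesgue_space E] f -> (forall y, (0 <= f y)%R) ->
  exists g, borel_majorant f g.
Proof.
move=> mf f0.
(* An enumeration of the nonnegative rationals with repetitions; indices that code no rational give
   0. *)
pose q (i : nat) : R := `|ratr (odflt 0%R (unpickle i : option rat))|%R.
have q0 i : (0 <= q i)%R by exact: normr_ge0.
have mco B : measurable B -> measurable (co @^-1` B).
  by move=> mB; rewrite -[X in measurable X]setTI; exact: measurable_onb_coords.
have mA i : measurable (f @^-1` `]q i, +oo[%classic).
  by rewrite -[X in measurable X]setTI; apply: mf => //; exact: measurable_itv.
have /choice[B HB] : forall i, exists B : set (T n), [/\ measurable B,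
    f @^-1` `]q i, +oo[%classic `<=` co @^-1` B &
    lebesgue E ((co @^-1` B) `\` f @^-1` `]q i, +oo[%classic) = 0].
  by move=> i; exact: lebesgue_hull.
pose h i t := (q i * \1_(B i) t)%:E.
have h0 i t : 0 <= h i t by rewrite lee_fin mulr_ge0// indicE.
pose g t := esups (h ^~ t) 0%N.
have hg i t : h i t <= g t by apply: ereal_sup_ubound; exists i.
have g0 t : 0 <= g t by exact: le_trans (hg 0%N t).
suff fg y : (f y)%:E <= g (co y).
  exists g; split => //.
- apply: measurable_fun_esups => i; apply/measurable_EFinP; apply: measurable_funM => //.
  by apply: measurable_indic; case: (HB i).
- exists (\bigcup_i ((co @^-1` (B i)) `\` f @^-1` `]q i, +oo[%classic)).
  have mN i : measurable ((co @^-1` (B i)) `\` f @^-1` `]q i, +oo[%classic).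
    by apply: measurableD => //; apply: mco; case: (HB i).
  split; first exact: bigcup_measurable.
    apply/negligibleP; first exact: bigcup_measurable.
    by apply: negligible_bigcup => i; apply/negligibleP => //; case: (HB i).
  move=> y /= gy; apply: contrapT => Ny; apply: gy; apply/eqP; rewrite eq_le.
  apply/andP; split.
    apply: ge_ereal_sup => _ [i _ <-]; rewrite /h indicE.
    have [yB|yB] := boolP (co y \in B i); last by rewrite mulr0 lee_fin.
    rewrite mulr1 lee_fin; apply: ltW; apply: contrapT => qf.
    apply: Ny; exists i => //; split; first by rewrite inE in yB.
    by rewrite /= in_itv/= andbT.
  exact: fg.
apply/lee_addgt0Pr => e e0.
  have [fy0|fy0] := leP (f y) 0%R.
    apply: (@le_trans _ _ 0); first by rewrite lee_fin.
    by apply: adde_ge0; rewrite ?g0// lee_fin ltW.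
  have lt : (Num.max 0%R (f y - e) < f y)%R by rewrite gt_max fy0/= ltrBlDr ltrDl.
  have [r] := rat_in_itvoo lt; rewrite in_itv/= gt_max => /andP[/andP[r0 re] rf].
  have qr : q (pickle r) = ratr r by rewrite /q pickleK/= gtr0_norm.
  have : h (pickle r) (co y) = (ratr r)%:E.
    rewrite /h qr indicE mem_set ?mulr1//; have [_ + _] := HB (pickle r); apply.
    by rewrite /= in_itv/= qr rf.
  move=> hr; apply: (@le_trans _ _ ((ratr r)%:E + e%:E)).
    by rewrite -EFinD lee_fin; rewrite ltrBlDr in re; exact: ltW.
  by rewrite leeD2r// -hr.
Qed.

End Majorant.

Lemma inve_ge1 (p : \bar R) : 1 <= p ->
  p^-1 = (fine p^-1)%:E /\ (0 <= fine p^-1 <= 1)%R.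
Proof.
case: p => [r||]; rewrite ?lee_fin => r1; last by rewrite leeNy_eq in r1.
  have r0 : (0 < r)%R by apply: lt_le_trans r1.
  rewrite inver gt_eqF//=; split => //.
  by rewrite invr_ge0 (ltW r0) invf_le1.
by rewrite invey/= lexx ler01.
Qed.

Lemma lee_prod_ge0 (I : Type) (r : seq I) (x y : I -> \bar R) :
  (forall i, 0 <= x i) -> (forall i, x i <= y i) ->
  \prod_(i <- r) x i <= \prod_(i <- r) y i.
Proof.
move=> x0 xy; have : 0 <= \prod_(i <- r) x i <= \prod_(i <- r) y i.
  apply: (big_ind2 (fun a b => 0 <= a <= b)) => [|a b c d /andP[a0 ab] /andP[c0 cd]|i _].
  - by rewrite lee01 lexx.
  - by rewrite mule_ge0//= lee_pmul.
  - by rewrite x0 xy.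
by case/andP.
Qed.

Lemma coord_le_hnorm (E : hilbertType R) (v : E) i :
  (`|rVof (onb E) v ord0 i| <= hnorm v)%R.
Proof.
rewrite -(@ler_pXn2r _ 2)// ?nnegrE ?sqrtr_ge0// hnorm_sqr real_normK ?num_real//.
by rewrite (bigD1 i)//= lerDl sumr_ge0// => j _; exact: sqr_ge0.
Qed.

Section MajorantNorm.
Variable E : hilbertType R.
Local Notation n := (\dim {:E}).
Local Notation co := (@onb_coords R E : lebesgue_space E -> T n).
Variables (f : lebesgue_space E -> R) (g : T n -> \bar R).
Hypothesis mf : measurable_fun [set: lebesgue_space E] f.
Hypothesis f0 : forall y, (0 <= f y)%R.
Hypothesis fg : borel_majorant f g.

Let mg : measurable_fun setT g. Proof. by case: fg. Qed.
Let g0 t : 0 <= g t. Proof. by case: fg. Qed.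

Lemma Lnorm_majorant (r : R) :
  Lnorm (lebesgue E) r%:E (EFin \o f) = (\int[lam n]_t (g t `^ r)) `^ r^-1.
Proof.
rewrite unlock; congr (_ `^ _).
have mgr : measurable_fun setT (fun t => g t `^ r).
  exact: (measurableT_comp (measurable_poweR _) mg).
rewrite -(lebesgue_integral_coords measurableT mgr); last by move=> x; exact: poweR_ge0.
rewrite preimage_setT.
have m1 : measurable_fun [set: lebesgue_space E] ((fun t => g t `^ r) \o co).
  by apply: (measurableT_comp mgr); exact: measurable_onb_coords.
have m2 : measurable_fun setT (fun y : lebesgue_space E => `|(EFin \o f) y| `^ r).
  have m2 : measurable_fun setT (abse \o (EFin \o f)).
    by apply: measurableT_comp; [exact: abse_measurable|exact/measurable_EFinP].
  exact: measurableT_comp (measurable_poweR r) m2.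
apply: ge0_ae_eq_integral; [exact: measurableT|exact: m2|exact: m1| | |].
- by move=> y _; exact: poweR_ge0.
- by move=> y _; exact: poweR_ge0.
- by case: fg => _ _ _; apply: filterS => y gy _; rewrite /= gy ger0_norm.
Qed.

Lemma majorant_gt_Lnormy : lam n [set t | Lnorm (lebesgue E) +oo (EFin \o f) < g t] = 0.
Proof.
have mZ : measurable [set t | Lnorm (lebesgue E) +oo (EFin \o f) < g t].
  by rewrite -[X in measurable X]setTI; exact: emeasurable_fun_o_infty.
rewrite -lebesgue_preimage//.
(* At [+oo] the norm is the essential supremum only if the whole space has positive measure. *)
have muT : 0 < lebesgue E setT.
  rewrite -(preimage_setT (@onb_coords R E)) lebesgue_preimage//.
  apply: (@lt_le_trans _ _ (lam n (box 1))).
    by rewrite lebesgue_tuple_box// lte_fin exprn_gt0// mulr1.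
  by apply: le_measure; rewrite ?inE//; exact: measurable_box.
apply/negligibleP.
  by rewrite -[X in measurable X]setTI; exact: measurable_onb_coords.
have [_ _ _ gae] := fg.
have fae := ess_sup_ge (lebesgue E) (abse \o (EFin \o f)).
have : {ae lebesgue E, forall y, ~ (Lnorm (lebesgue E) +oo (EFin \o f) < g (co y))}.
  apply: filterS2 gae fae => y gy fy; apply/negP; rewrite -leNgt gy unlock muT.
  by apply: le_trans fy; rewrite /= ger0_norm.
by apply: negligibleS => y /= H; apply.
Qed.

(** This brings the majorant to the form K F^(1/p) that [bl_bound] expects. For finite p, [K] is 1
    and [F] is the p-th power; for p = +oo, [F] is 1, [K] is the norm, and the points where [g]
    exceeds it form the null set [Z]. In the latter case the integral of [F] may be infinite, but it
    is raised to the power 0. *)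
Lemma majorant_split (p : \bar R) : 1 <= p ->
  exists (K : \bar R) (F : T n -> \bar R) (Z : set (T n)),
    [/\ 0 <= K, measurable_fun setT F, forall t, 0 <= F t &
    [/\ measurable Z, lam n Z = 0, forall t, ~ Z t -> g t <= K * F t `^ fine p^-1 &
      K * (\int[lam n]_t F t) `^ fine p^-1 = Lnorm (lebesgue E) p (EFin \o f)]].
Proof.
case: p => [r||] p1; last by rewrite leeNy_eq in p1.
  have r0 : (0 < r)%R by rewrite lee_fin in p1; apply: lt_le_trans p1.
  exists 1, (fun t => g t `^ r), set0; rewrite inver gt_eqF//=; split => //.
  - exact: (measurableT_comp (measurable_poweR _) mg).
  - by move=> t; exact: poweR_ge0.
  split => //.
  - by move=> t _; rewrite -poweRrM mulfV ?gt_eqF// poweRe1// mul1e.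
  - by rewrite mul1e Lnorm_majorant.
exists (Lnorm (lebesgue E) +oo (EFin \o f)), (cst 1),
  [set t | Lnorm (lebesgue E) +oo (EFin \o f) < g t].
rewrite (_ : fine (+oo : \bar R)^-1 = 0%R)//; split => //.
- exact: Lnorm_ge0.
split.
- by rewrite -[X in measurable X]setTI; exact: emeasurable_fun_o_infty.
- exact: majorant_gt_Lnormy.
- by move=> t tZ; rewrite poweRe0 mule1 leNgt; apply/negP.
- by rewrite poweRe0 mule1.
Qed.

End MajorantNorm.

(** Only an inequality: for p = +oo the right side is 1 even if [B] is null. *)
Lemma Lnorm_indic_le (E : hilbertType R) (p : \bar R) (B : set (T (\dim {:E}))) :
  1 <= p -> measurable B ->
  Lnorm (lebesgue E) p (EFin \o (fun y => \1_B (onb_coords y))) <=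
  (lam _ B) `^ fine p^-1.
Proof.
case: p => [r||] p1 mB; last by rewrite leeNy_eq in p1.
  have r0 : (0 < r)%R by rewrite lee_fin in p1; apply: lt_le_trans p1.
  rewrite unlock inver gt_eqF//=.
  rewrite (measureEintegral _ mB) -(lebesgue_integral_coords measurableT); last 2 first.
  - exact: measurable_EFin_indic.
  - exact: EFin_indic_ge0.
  rewrite preimage_setT.
  rewrite le_eqVlt; apply/orP; left; apply/eqP; congr (_ `^ _).
  apply: eq_integral => y _; rewrite /= indicE.
  by case: (_ \in _); rewrite ?normr1 ?normr0 ?powR1 ?powR0// gt_eqF.
rewrite unlock invey/= poweRe0; case: ifPn => // _.
apply/ess_supP; apply: nearW => y; rewrite /= indicE lee_fin.
by case: (_ \in _); rewrite ?normr1 ?normr0.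
Qed.

Lemma dep_choice (I : Type) (X : I -> Type) (Q : forall i, X i -> Prop) :
  (forall i, exists x, Q i x) -> exists h : forall i, X i, forall i, Q i (h i).
Proof. by move=> ex; exists (fun i => sval (cid (ex i))) => i; exact: svalP. Qed.

(** * Transfer between Hilbert spaces and coordinates *)

Section Link.
Variables (m : nat) (H H0 : hilbertType R) (Hj : 'I_m -> hilbertType R).
Variables (l0 : 'Hom(H, H0)) (l : forall j, 'Hom(H, Hj j)).
Hypothesis l_surj : forall j (z : Hj j), exists y : H, l j y = z.
Variables (p : 'I_m -> \bar R).
Hypothesis p_ge1 : forall j, 1 <= p j.

Local Notation n := (\dim {:H}).
Let nj j := \dim {:Hj j}.
Let s j : R := fine (p j)^-1.
Let L0 := lin_mx l0.
Let L j := lin_mx (l j).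
Let D := [set y : H | (hnorm (l0 y) <= 1)%R].

Let sumE (x : 'I_m -> nat) :
  \sum_(j < m) (p j)^-1 * (x j)%:R%:E = ((\sum_j s j * (x j)%:R)%R)%:E.
Proof.
rewrite -sumEFin; apply: eq_bigr => j _.
by have [-> _] := inve_ge1 (p_ge1 j); rewrite -EFinM.
Qed.

Let s01 j : (0 <= s j <= 1)%R. Proof. by case: (inve_ge1 (p_ge1 j)). Qed.

Lemma feasibleP : feasible L0 L s <->
  ((forall V : {vspace H}, (V <= lker l0)%VS ->
      (\dim V)%:R%:E <= \sum_(j < m) (p j)^-1 * (\dim (l j @: V)%VS)%:R%:E) /\
   (forall V : {vspace H},
      \sum_(j < m) (p j)^-1 * (codim (l j @: V)%VS)%:R%:E <= (codim V)%:R%:E)).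
Proof.
have codimE (E : hilbertType R) (U : {vspace E}) u (V : 'M[R]_(u, \dim {:E})) :
    spans U V -> ((codim U)%:R = (\dim {:E})%:R - (\rank V)%:R :> R)%R.
  by move=> UV; rewrite /codim (spans_dim UV) natrB// rank_leq_col.
have kerE (U : {vspace H}) u (V : 'M[R]_(u, n)) : spans U V ->
    (\dim U)%:R%:E <= \sum_(j < m) (p j)^-1 * (\dim (l j @: U)%VS)%:R%:E =
    ((\rank V)%:R <= \sum_j s j * (\rank (V *m L j))%:R)%R.
  move=> UV; rewrite sumE lee_fin (spans_dim UV); congr (_ <= _)%R.
  by apply: eq_bigr => j _; rewrite (spans_dim (spans_limg (l j) UV)).
have cokerE (U : {vspace H}) u (V : 'M[R]_(u, n)) : spans U V ->
    \sum_(j < m) (p j)^-1 * (codim (l j @: U)%VS)%:R%:E <= (codim U)%:R%:E =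
    (\sum_j s j * ((nj j)%:R - (\rank (V *m L j))%:R) <= n%:R - (\rank V)%:R)%R.
  move=> UV; rewrite sumE lee_fin (codimE _ _ _ _ UV); congr (_ <= _)%R.
  by apply: eq_bigr => j _; rewrite (codimE _ _ _ _ (spans_limg (l j) UV)).
split=> [[_ f1 f2]|[c1 c2]].
  split=> U; have UV := spans_msof U.
    by move=> /(spans_lker l0 UV) VL0; rewrite (kerE _ _ _ UV); exact: f1.
  by rewrite (cokerE _ _ _ UV); exact: f2.
split => // u V; have UV := spans_vsof V.
  by move=> /(spans_lker l0 UV) /c1; rewrite (kerE _ _ _ UV).
by rewrite -(cokerE _ _ _ UV); exact: c2.
Qed.

Lemma bl_bound_hilbert : bl_bound L0 L s ->
  exists C : R, forall f : forall j, lebesgue_space (Hj j) -> R,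
    (forall j, measurable_fun [set: lebesgue_space (Hj j)] (f j)) ->
    (forall j z, (0 <= f j z)%R) ->
    \int[lebesgue H]_(y in D) \prod_(j < m) (f j (l j y))%:E
      <= C%:E * \prod_(j < m) Lnorm (lebesgue (Hj j)) (p j) (EFin \o f j).
Proof.
move=> [C C0 HC]; exists C => f mf f0.
have /dep_choice[g Hg] : forall j, exists g, borel_majorant (f j) g.
  by move=> j; exact: exists_borel_majorant.
have /dep_choice[K HK] := fun j => majorant_split (mf j) (f0 j) (Hg j) (p_ge1 j).
have /dep_choice[F HF] := HK.
have /dep_choice[Z HZ] := HF.
have K0 j : 0 <= K j by case: (HZ j).
have mF j : measurable_fun setT (F j) by case: (HZ j).
have F0 j t : 0 <= F j t by case: (HZ j).
have mZ j : measurable (Z j) by case: (HZ j) => _ _ _ [].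
have Z0 j : lam _ (Z j) = 0 by case: (HZ j) => _ _ _ [].
have gKF j t : ~ Z j t -> g j t <= K j * F j t `^ s j.
  by case: (HZ j) => _ _ _ [_ _ + _]; exact.
have KF j : K j * (\int[lam _]_t F j t) `^ s j =
    Lnorm (lebesgue (Hj j)) (p j) (EFin \o f j).
  by case: (HZ j) => _ _ _ [].
have mg j : measurable_fun setT (g j) by case: (Hg j).
have g0 j t : 0 <= g j t by case: (Hg j).
have fleg j y : (f j y)%:E <= g j (onb_coords y) by case: (Hg j).
have mL j := measurable_linear_map (L j).
pose G t := \prod_j g j (linear_map (L j) t).
have mG : measurable_fun setT G.
  by apply: emeasurable_prod => j; exact: (measurableT_comp (mg j) (mL j)).
have G0 t : 0 <= G t by apply: eprod_ge0.
pose P t := \prod_j F j (linear_map (L j) t) `^ s j.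
have mP : measurable_fun setT P by exact: measurable_bl_integrand.
have P0 t : 0 <= P t by apply: eprod_ge0 => j _; exact: poweR_ge0.
have mcut := measurable_cut L0 0%R.
have PK0 : 0 <= \prod_j K j by apply: eprod_ge0.
apply: (@le_trans _ _ (\int[lebesgue H]_(y in @onb_coords R H @^-1` cut L0 0%R)
    G (onb_coords y))).
  rewrite integral_mkcond [leRHS]integral_mkcond; apply: ge0_le_integral_nomeas => y _.
    by apply: erestrict_ge0 => z _; apply: eprod_ge0 => j _; rewrite lee_fin.
  rewrite !patchE; case: ifPn => yD; last first.
    by case: ifPn => // _; exact: G0.
  (* Each coordinate is bounded by the norm, so the unit ball of H_0 lies in the cube that defines
     the cut-off. *)
  rewrite ifT; last first.
    rewrite inE /= /cut/= addr0 => i; rewrite tnth_mktuple.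
    rewrite row_of_onb_coords -(rVof_app _ (onb_basis H)).
    by apply: le_trans (coord_le_hnorm _ _) _; rewrite inE in yD.
  apply: lee_prod_ge0 => j; first by rewrite lee_fin.
  by rewrite -onb_coords_lin.
rewrite lebesgue_integral_coords//.
apply: (@le_trans _ _ (\int[lam n]_(t in cut L0 0%R) ((\prod_j K j) * P t))).
  apply: ae_ge0_le_integral => //.
  - exact: measurable_funTS.
  - by move=> t _; exact: mule_ge0.
  - by apply: measurable_funTS; exact: measurable_funeM.
  (* The bound of each majorant by K F^(1/p) fails only on [Z j], whose preimage under the
     surjective [L j] is null. *)
  have : {ae lam n, forall t, forall j, ~ Z j (linear_map (L j) t)}.
    apply: filter_forall => j; exists (linear_map (L j) @^-1` Z j); split.
    - by rewrite -[X in measurable X]setTI; apply: mL => //; exact: mZ.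
    - by apply: null_preimage => //; apply: lin_mx_full; exact: l_surj.
    - by move=> t /= /contrapT.
  apply: filterS => t tZ _; rewrite /G /P -big_split/=.
  by apply: lee_prod_ge0 => j; [exact: g0|exact/gKF/tZ].
rewrite ge0_integralZl//; last exact: measurable_funTS.
apply: (@le_trans _ _ ((\prod_j K j) * (C%:E * \prod_j (\int[lam _]_t F j t) `^ s j))).
  by apply: lee_wpmul2l => //; exact: HC.
rewrite muleCA; under [X in _ <= _ * X]eq_bigr do rewrite -KF.
by rewrite big_split.
Qed.

Lemma hilbert_feasible :
  (exists C : R, forall f : forall j, lebesgue_space (Hj j) -> R,
    (forall j, measurable_fun [set: lebesgue_space (Hj j)] (f j)) ->
    (forall j z, (0 <= f j z)%R) ->
    \int[lebesgue H]_(y in D) \prod_(j < m) (f j (l j y))%:E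
      <= C%:E * \prod_(j < m) Lnorm (lebesgue (Hj j)) (p j) (EFin \o f j)) ->
  feasible L0 L s.
Proof.
move=> [C HC].
(* The given constant may be negative. *)
pose C' := Num.max C 0%R.
have C'0 : (0 <= C')%R by rewrite le_max lexx orbT.
(* The squares of dim H_0 coordinates, each at most de^2 <= de, add up to at most dim H_0 / (dim H_0
   + 1) <= 1. The successor keeps [de] positive when H_0 is zero. *)
pose de : R := ((\dim {:H0}).+1%:R^-1)%R.
have de0 : (0 < de)%R by rewrite invr_gt0.
have s0 j : (0 <= s j)%R by case/andP: (s01 j).
have bound (S : set (T n)) (Sj : forall j, set (T (nj j))) :
    measurable S -> (forall j, measurable (Sj j)) ->
    (forall x, S x -> box de (linear_map L0 x)) ->
    (forall j x, S x -> Sj j (linear_map (L j) x)) ->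
    lam n S <= C'%:E * \prod_j (lam (nj j) (Sj j)) `^ s j.
  move=> mS mSj SL0 SL.
  pose f j (z : lebesgue_space (Hj j)) : R := \1_(Sj j) (onb_coords z).
  have mf j : measurable_fun [set: lebesgue_space (Hj j)] (f j).
    apply: (measurableT_comp (f := \1_(Sj j) : T (nj j) -> R)).
      by apply: measurable_indic; exact: mSj.
    exact: measurable_onb_coords.
  have f0 j z : (0 <= f j z)%R by rewrite /f indicE.
  apply: (@le_trans _ _ (C'%:E * \prod_(j < m) Lnorm (lebesgue (Hj j)) (p j) (EFin \o f j))); last first.
    apply: lee_wpmul2l; first by rewrite lee_fin.
    apply: lee_prod_ge0 => j; first exact: Lnorm_ge0.
    by apply: Lnorm_indic_le; [exact: p_ge1|exact: mSj].
  apply: (@le_trans _ _ (C%:E * \prod_(j < m) Lnorm (lebesgue (Hj j)) (p j) (EFin \o f j))); last first.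
    apply: lee_wpmul2r; first by apply: eprod_ge0 => j _; exact: Lnorm_ge0.
    by rewrite lee_fin le_max lexx.
  apply: le_trans (HC f mf f0).
  rewrite (measureEintegral _ mS) -(lebesgue_integral_coords measurableT); last 2 first.
  - exact: measurable_EFin_indic.
  - exact: EFin_indic_ge0.
  rewrite preimage_setT [leRHS]integral_mkcond; apply: ge0_le_integral_nomeas => y _.
    exact: EFin_indic_ge0.
  rewrite indicE; have [yS|yS] := boolP (onb_coords y \in S); last first.
    by apply: erestrict_ge0 => z _; apply: eprod_ge0 => j _; rewrite lee_fin.
  rewrite inE in yS.
  rewrite patchE ifT.
    rewrite big1// => j _; rewrite /f indicE onb_coords_lin mem_set//.
    exact: SL.
  rewrite inE /D/= -(@ler_pXn2r _ 2)// ?nnegrE ?sqrtr_ge0// hnorm_sqr expr1n.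
  apply: (@le_trans _ _ (\sum_(i < \dim {:H0}) de)%R).
    apply: ler_sum => i _; have := SL0 _ yS i.
    rewrite -onb_coords_lin onb_coordsE tnth_mktuple => hi.
    rewrite -real_normK ?num_real//.
    have de1 : (de <= 1)%R by rewrite invf_le1// ler1n.
    apply: (@le_trans _ _ (de ^+ 2)%R); first by rewrite ler_pXn2r ?nnegrE// ltW.
    by rewrite expr2 ler_piMr// ltW.
  rewrite sumr_const card_ord -mulr_natl /de ler_pdivrMr// mul1r ler_nat.
  exact: leqnSn.
split => // u V.
  exact: (necessary_ker s0 C'0 de0 bound).
exact: (necessary_codim s0 C'0 de0 bound).
Qed.

End Link.

End BrascampLieb.

Theorem theorem2p3 (R : realType) (m : nat) (m_ge1 : (1 <= m)%N)
    (H H0 : hilbertType R) (Hj : 'I_m -> hilbertType R)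
    (Hj_gt0 : forall j, (0 < \dim {:Hj j})%N)
    (l0 : 'Hom(H, H0)) (l : forall j, 'Hom(H, Hj j))
    (l_surj : forall j (z : Hj j), exists y : H, l j y = z)
    (p : 'I_m -> \bar R) (p_ge1 : forall j, 1 <= p j) :
  (exists C : R, forall f : forall j, lebesgue_space (Hj j) -> R,
    (forall j, measurable_fun [set: lebesgue_space (Hj j)] (f j)) ->
    (forall j z, (0 <= f j z)%R) ->
    \int[lebesgue H]_(y in [set y : H | (hnorm (l0 y) <= 1)%R])
        \prod_(j < m) (f j (l j y))%:E
      <= C%:E * \prod_(j < m) Lnorm (lebesgue (Hj j)) (p j) (EFin \o f j))
  <->
  ((forall V : {vspace H}, (V <= lker l0)%VS ->
      (\dim V)%:R%:E <= \sum_(j < m) (p j)^-1 * (\dim (l j @: V)%VS)%:R%:E) /\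
   (forall V : {vspace H},
      \sum_(j < m) (p j)^-1 * (codim (l j @: V)%VS)%:R%:E <= (codim V)%:R%:E)).
Proof.
apply: iff_trans (feasibleP l0 l p_ge1); split.
  exact: hilbert_feasible.
by move=> /feasible_bl_bound; exact: bl_bound_hilbert.
Qed.
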